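(* Let $d\ge 1$ and $n\ge 1$ be integers, let $(\Omega,\mathcal{F},\mathbb{P})$ be an atomless probability space, and let $U:\Omega\to[0,1]^d$ be a random variable uniformly distributed on $[0,1]^d$. Let $f:[0,1]^d\to\mathbb{R}$ be continuous. Let $\psi:[0,1]\to[0,1]$ be continuous, increasing (in the weak sense, i.e. nondecreasing) and concave with $\psi(0)=0$ and $\psi(1)=1$, and let $c_\psi(A)=\psi(\mathbb{P}(A))$ for $A\in\mathcal{F}$. Let $u_1,\ldots,u_n\in[0,1]^d$, and let $\tau$ be a permutation of $\{1,\ldots,n\}$ such that $f(u_{\tau(1)})\le\cdots\le f(u_{\tau(n)})$. Put $$I^{(n)}(f)=f(u_{\tau(1)})+\sum_{i=2}^n\bigl(f(u_{\tau(i)})-f(u_{\tau(i-1)})\bigr)\,\psi\!\left(\frac{n-i+1}{n}\right),$$ and let $\rho_n:=\rho\bigl(f;D^*(u_1,\ldots,u_n)^{1/d}\bigr)$, where $D^*$ is the star discrepancy and $\rho(f;\cdot)$ is the modulus of continuity of $f$ with respect to the max norm. Then the following hold. (i) If $\rho_n<1$, then $$\left|\int f(U)\,dc_\psi-I^{(n)}(f)\right|\le\left(2\max_{u\in[0,1]^d}|f(u)|+4\right)\psi(\rho_n).$$ (ii) If $\psi_+'(0)<\infty$, then $$\left|\int f(U)\,dc_\psi-I^{(n)}(f)\right|\le 4\,\psi_+'(0)\,\rho_n.$$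
   Context: Choquet integral: for a bounded random variable $X$ on $(\Omega,\mathcal{F},\mathbb{P})$, $$\int X\,dc_\psi:=\int_0^\infty c_\psi(X>x)\,dx+\int_{-\infty}^0\bigl(c_\psi(X>x)-1\bigr)\,dx,$$ where $c_\psi(X>x)=\psi(\mathbb{P}(X>x))$. Star discrepancy: for points $x_1,\ldots,x_m\in[0,1]^d$, $$D^*(x_1,\ldots,x_m)=\sup\left\{\left|\frac1m\sum_{j=1}^m 1_B(x_j)-\mathrm{Leb}(B)\right| : B=\prod_{i=1}^d[0,\xi_i),\ \xi_1,\ldots,\xi_d\in[0,1]\right\},$$ where $\mathrm{Leb}$ is Lebesgue measure on $[0,1]^d$ and $1_B$ is the indicator function of $B$. Modulus of continuity: for $g:[0,1]^d\to\mathbb{R}$ and $t\ge 0$, $$\rho(g;t)=\sup\{|g(x)-g(y)| : x,y\in[0,1]^d,\ |x-y|\le t\},$$ where $|x|=\max_i|x^i|$ is the max norm of a vector $x$. Right derivative: $\psi_+'(t)=\lim_{s\searrow t}\dfrac{\psi(s)-\psi(t)}{s-t}$ for $t\in[0,1)$, which exists by concavity of $\psi$ and may equal $+\infty$ at $t=0$. *)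

(* Defs.v *)
From HB Require Import structures.
From mathcomp Require Import all_boot all_order all_algebra all_fingroup.
From mathcomp Require Import all_classical all_reals all_analysis.

Set Implicit Arguments.
Unset Strict Implicit.
Unset Printing Implicit Defensive.

Import Order.TTheory GRing.Theory Num.Theory.
Import numFieldNormedType.Exports.

Local Open Scope classical_set_scope.
Local Open Scope ring_scope.

(* Borel sigma-algebra of R^d.  The topology and the norm of 'rV[R]_d are those
   of the max norm. *)
Definition borel_rV (R : realType) (d : nat) :=
  g_sigma_algebraType (@open 'rV[R]_d).

Definition cube (R : realType) (d : nat) : set 'rV[R]_d :=
  [set x | forall i, 0 <= x 0 i <= 1].

(* d-dimensional Lebesgue measure as an iterated integral: in dimension d.+1 it
   is the product of lebesgue_measure on the first coordinate (row_mx x%:M v is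
   the point (x, v)) and of the d-dimensional measure, cf. product_measure1. *)
Fixpoint leb (R : realType) (d : nat) : set 'rV[R]_d -> \bar R :=
  match d with
  | 0 => fun A => (\1_A (0 : 'rV[R]_0))%:E
  | d'.+1 => fun A =>
      (\int[@lebesgue_measure R]_x
         leb [set v : 'rV[R]_d' | A (row_mx x%:M v)])%E
  end.

Definition corner_box (R : realType) (d : nat) (xi : 'rV[R]_d) : set 'rV[R]_d :=
  [set x | forall i, 0 <= x 0 i < xi 0 i].

Definition star_discrepancy (R : realType) (d m : nat)
    (x : 'I_m -> 'rV[R]_d) : R :=
  sup [set `| m%:R^-1 * \sum_(j < m) \1_(corner_box xi) (x j)
              - fine (leb (corner_box xi)) | | xi in @cube R d].

Definition modulus (R : realType) (d : nat) (g : 'rV[R]_d -> R) (t : R) : R :=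
  sup [set r : R | exists x y : 'rV[R]_d,
    [/\ cube x, cube y, `|x - y| <= t & r = `|g x - g y|]].

Definition atomless d (T : measurableType d) (R : realType)
    (P : probability T R) : Prop :=
  forall A : set T, measurable A -> (0 < P A)%E ->
    exists B : set T, [/\ measurable B, B `<=` A & (0 < P B < P A)%E].

Definition uniform_cube d (T : measurableType d) (R : realType)
    (P : probability T R) (k : nat) (U : {RV P >-> borel_rV R k}) : Prop :=
  forall A : set (borel_rV R k), measurable A ->
    distribution P U A = leb (A `&` @cube R k).

Definition distorted_prob d (T : measurableType d) (R : realType)
    (P : probability T R) (psi : R -> R) (A : set T) : R :=
  psi (fine (P A)).

Definition choquet d (T : measurableType d) (R : realType)
    (P : probability T R) (psi : R -> R) (X : T -> R) : R :=
  \int[@lebesgue_measure R]_(x in `[0, +oo[)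
     distorted_prob P psi [set w | x < X w]
  + \int[@lebesgue_measure R]_(x in `]-oo, 0])
     (distorted_prob P psi [set w | x < X w] - 1).

(* Taken in \bar R: it may be +oo. *)
Definition right_derive (R : realType) (psi : R -> R) (t : R) : \bar R :=
  lim (((psi s - psi t) / (s - t))%:E @[s --> t^'+]).

(* For sorted values y, indexed from 0: the i-th increment here is the (i+1)-st
   with indices starting at 1, hence the weight psi ((n - i) / n). *)
Definition choquet_sample (R : realType) (n : nat) (psi : R -> R)
    (y : 'I_n -> R) : R :=
  let s := [seq y i | i <- enum 'I_n] in
  s`_0 + \sum_(1 <= i < n) (s`_i - s`_i.-1) * psi ((n - i)%:R / n%:R).

(* For f continuous on the cube, this supremum is attained. *)
Definition sup_norm_cube (R : realType) (d : nat) (f : 'rV[R]_d -> R) : R :=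
  sup [set `|f u| | u in @cube R d].

(* Main.v *)
(* Put a(s) = P (f(U) > s) and let b(s) be the fraction of the u_j with
   f(u_j) > s.  Both sides of the estimate are Choquet integrals, of [psi o a]
   and [psi o b], and are compared through Riemann sums over thresholds
   M - (i+1)h, where M = max |f|.

   For concave phi with phi(0) = 0 and phi(t) <= kappa t, the secant slopes of
   phi at the pairs (a(s), b(s)) are monotone in s and lie in [0, kappa], so
   Abel summation bounds |sum (phi(a) - phi(b))| by kappa times the largest
   partial sum of a - b.  Such a partial sum is the integration error of a
   staircase approximation of (f - s)^+, which is at most 4 rho by Proinov's
   inequality.  Part (ii) takes phi = psi and kappa = psi'_+(0); part (i) takes
   phi(t) = min (psi t, kappa t) with kappa = psi(rho) / rho, which differs from
   psi by at most psi(rho).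

   For Proinov's inequality, with D = delta^d the discrepancy: a function F with
   |F x - F y| <= w for |x - y| <= delta is within w/2 of a (w/delta)-Lipschitz
   function (an infimal convolution), which is sampled at the centres of m^d
   cells.  Summing by parts in one coordinate after the other leaves
   ((2m-1)^d - 1)/2 corner-anchored boxes, each weighted by a difference of
   adjacent samples, and m is chosen of the order of 1/(2 delta). *)
Require Import Defs.
From HB Require Import structures.
From mathcomp Require Import all_boot all_order all_algebra all_fingroup.
From mathcomp Require Import all_classical all_reals all_analysis.
From mathcomp Require Import measurable_realfun.
From mathcomp Require Import ring lra zify.

Set Implicit Arguments.
Unset Strict Implicit.
Unset Printing Implicit Defensive.

Import Order.TTheory GRing.Theory Num.Theory.
Import numFieldNormedType.Exports.

Local Open Scope classical_set_scope.
Local Open Scope ring_scope.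

(** * Summation by parts on grids *)

Lemma abel_sum (R : comPzRingType) (g v : nat -> R) m :
  \sum_(j < m.+1) g j * v j =
  g m * (\sum_(i < m.+1) v i) + \sum_(j < m) (g j - g j.+1) * (\sum_(i < j.+1) v i).
Proof.
elim: m => [|m IHm]; first by rewrite !big_ord_recr !big_ord0/= addr0 !add0r.
rewrite big_ord_recr/= IHm [\sum_(j < m.+1) (_ - _) * _]big_ord_recr/=.
by rewrite [\sum_(i < m.+2) v i]big_ord_recr/=; ring.
Qed.

(** Multi-indices are lists, so that splitting off the first coordinate in an induction on [d] is a
    plain cons. *)
Fixpoint grid (m d : nat) : seq (seq nat) :=
  if d is d'.+1 then [seq j :: k | j <- iota 0 m, k <- grid m d'] else [:: [::]].

Lemma mem_grid m d k : (k \in grid m d) = (size k == d) && all (fun i => i < m)%N k.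
Proof.
elim: d k => [|d IHd] k /=; first by rewrite inE; case: k.
apply/allpairsP/idP => [[[i l] /= [+ + ->]]|].
  by rewrite mem_iota add0n IHd => /andP[_ im] /andP[/eqP<- lm]; rewrite /= eqxx im.
case: k => [//|i l] /andP[/= sl /andP[im lm]]; exists (i, l) => /=; split => //.
  by rewrite mem_iota.
by rewrite IHd -eqSS sl.
Qed.

Lemma uniq_grid m d : uniq (grid m d).
Proof.
elim: d => [//|d IHd] /=.
by apply: allpairs_uniq; rewrite ?iota_uniq// => -[i k] [j l] _ _ [-> ->].
Qed.

Lemma big_grid0 (R : pzRingType) m (F : seq nat -> R) :
  \sum_(k <- grid m 0) F k = F [::].
Proof. by rewrite /= big_seq1. Qed.

Lemma big_gridS (R : pzRingType) m d (F : seq nat -> R) :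
  \sum_(k <- grid m d.+1) F k = \sum_(j < m) \sum_(k <- grid m d) F (nat_of_ord j :: k).
Proof. by rewrite big_allpairs_dep -{1}(subn0 m) -/(index_iota 0 m) big_mkord. Qed.

Lemma big_grid_indicator (R : pzRingType) m d (G : seq nat -> R) k0 :
  k0 \in grid m d -> \sum_(k <- grid m d) G k * (k0 == k)%:R = G k0.
Proof.
move=> k0g; rewrite (bigD1_seq k0) ?uniq_grid//= eqxx mulr1 big1 ?addr0// => k.
by rewrite eq_sym => /negPf->; rewrite mulr0.
Qed.

(** The mass that a weight [v] on cells gives to the corner-anchored box whose last cell is [l]; it
    is the discrete form of a local discrepancy. *)
Definition star_sum (R : pzRingType) m d (v : seq nat -> R) (l : seq nat) : R :=
  \sum_(k <- grid m d) v k * (all2 leq k l)%:R.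

Lemma star_sumS (R : pzRingType) m d (v : seq nat -> R) (j : 'I_m) l :
  star_sum m d.+1 v (nat_of_ord j :: l) =
  \sum_(i < m | (i <= j)%N) star_sum m d (fun k => v (nat_of_ord i :: k)) l.
Proof.
rewrite /star_sum big_gridS [RHS]big_mkcond/=; apply: eq_bigr => i _.
case: ifP => ij; first exact: eq_bigr.
by rewrite big1// => k _; rewrite mulr0.
Qed.

Lemma star_sum_suml (R : pzRingType) m d (I : Type) (r : seq I) (p : pred I)
    (v : I -> seq nat -> R) l :
  star_sum m d (fun k => \sum_(i <- r | p i) v i k) l =
  \sum_(i <- r | p i) star_sum m d (v i) l.
Proof.
rewrite /star_sum exchange_big/=; apply: eq_bigr => k _.
by rewrite mulr_suml.
Qed.

Section grid_bounds.
Variables (R : realFieldType) (m : nat).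
Local Notation M := (2 * m.+1%:R - 1 : R).

(** Inverting the box sums: in each coordinate the slice [0] is one box sum and each of the [m]
    other slices is a difference of two, which costs a factor 1 + 2m = [M] per coordinate. *)
Lemma sum_norm_grid_le d (v : seq nat -> R) (D : R) :
  (forall l, l \in grid m.+1 d -> `|star_sum m.+1 d v l| <= D) ->
  \sum_(k <- grid m.+1 d) `|v k| <= D * M ^+ d.
Proof.
elim: d v D => [|d IHd] v D vD.
  by have := vD [::] isT; rewrite /star_sum !big_grid0/= !mulr1.
rewrite big_gridS big_ord_recl exprS mulrA.
have M0 : 0 <= M ^+ d.
  by rewrite exprn_ge0// subr_ge0 mulr_natl -natrM ler1n.
have -> : D * (2 * m.+1%:R - 1) * M ^+ d = D * M ^+ d + \sum_(i < m) (2 * D) * M ^+ d.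
  by rewrite sumr_const card_ord -mulr_natr -(natr1 m); ring.
apply: lerD.
  apply: IHd => l lg; have := vD (0%N :: l).
  rewrite mem_grid /= eqSS -mem_grid => /(_ lg).
  rewrite -[0%N]/(nat_of_ord (@ord0 m)) star_sumS big_mkcond big_ord_recl/= big1 ?addr0//.
apply: ler_sum => j _; apply: IHd => l lg.
have h (i : 'I_m.+1) : `|star_sum m.+1 d.+1 v (nat_of_ord i :: l)| <= D.
  by apply: vD; move: lg; rewrite !mem_grid/= eqSS ltn_ord.
have jm : (j < m.+1)%N by rewrite ltnS ltnW.
(* Slice [j + 1] is the box sum up to [j + 1] minus the one up to [j], hence the bound [2 * D]. *)
have := h (Ordinal jm); have := h (lift ord0 j).
rewrite !star_sumS (bigD1 (lift ord0 j))//=.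
rewrite (eq_bigl (fun i : 'I_m.+1 => (i <= j)%N)); last first.
  move=> i; by rewrite -(inj_eq val_inj)/= /bump leq0n add1n andbC -ltn_neqAle.
move: (star_sum _ _ _ _) (\sum_(i < _ | _) _) => x y h1 h2.
have -> : x = (x + y) - y by ring.
by rewrite (le_trans (ler_normB _ _))// mulr2n mulrDl mul1r lerD.
Qed.

(** Abel summation in the first coordinate leaves the same problem in dimension [d] on the last
    slice, plus [m] slices weighted by adjacent differences of [G]. The constants obey C(d+1) = C(d)
    + m M^d with C(0) = 0, so that C(d) = (M^d - 1)/2. *)
Lemma sum_grid_le d (v G : seq nat -> R) (D b : R) : 0 <= b ->
  (forall s i t, `|G (s ++ i :: t) - G (s ++ i.+1 :: t)| <= b) ->
  (forall l, l \in grid m.+1 d -> `|star_sum m.+1 d v l| <= D) ->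
  `|\sum_(k <- grid m.+1 d) (G k - G (nseq d m)) * v k| <= b * D * (M ^+ d - 1) / 2.
Proof.
move=> b0; elim: d v G => [|d IHd] v G Gb vD.
  by rewrite big_grid0 subrr mul0r normr0 expr0 subrr mulr0 mul0r.
pose V (j : 'I_m.+1) k := \sum_(i < m.+1 | (i <= j)%N) v (nat_of_ord i :: k).
have VD j l : l \in grid m.+1 d -> `|star_sum m.+1 d (V j) l| <= D.
  move=> lg; rewrite star_sum_suml -star_sumS; apply: vD.
  by move: lg; rewrite !mem_grid/= eqSS ltn_ord.
(* [V j k] accumulates [v] over the first coordinates up to [j]; the box sums of [V j] are box sums
   of [v]. *)
have -> : \sum_(k <- grid m.+1 d.+1) (G k - G (nseq d.+1 m)) * v k =
    \sum_(k <- grid m.+1 d) (G (m :: k) - G (m :: nseq d m)) * V ord_max k +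
    \sum_(j < m) \sum_(k <- grid m.+1 d)
      (G (nat_of_ord j :: k) - G (j.+1 :: k)) * V (widen_ord (leqnSn m) j) k.
  rewrite big_gridS exchange_big/= [X in _ + X]exchange_big -big_split/=.
  apply: eq_bigr => k _.
  rewrite (abel_sum (fun j => G (j :: k) - G (m :: nseq d m)) (fun j => v (j :: k))).
  congr (_ * _ + _); first by apply: eq_bigl => i; rewrite -ltnS ltn_ord.
  apply: eq_bigr => j _; congr (_ * _); first by ring.
  by rewrite (big_ord_widen m.+1 (fun i => v (i :: k)) (ltnW (ltn_ord j) : (j.+1 <= m.+1)%N)).
have -> : b * D * (M ^+ d.+1 - 1) / 2 =
    b * D * (M ^+ d - 1) / 2 + \sum_(j < m) b * (D * M ^+ d).
  by rewrite sumr_const card_ord -[_ *+ m]mulr_natr exprS -(natr1 m); field.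
rewrite (le_trans (ler_normD _ _))// lerD//.
  apply: (IHd _ (fun k => G (m :: k))); last exact: VD.
  by move=> s i t; have := Gb (m :: s) i t.
rewrite (le_trans (ler_norm_sum _ _ _))//; apply: ler_sum => j _.
rewrite (le_trans (ler_norm_sum _ _ _))//.
rewrite (@le_trans _ _ (\sum_(k <- grid m.+1 d) b * `|V (widen_ord (leqnSn m) j) k|))//.
  by apply: ler_sum => k _; rewrite normrM ler_wpM2r//; have := Gb [::] j k.
by rewrite -mulr_sumr ler_wpM2l//; apply: sum_norm_grid_le; exact: VD.
Qed.
End grid_bounds.

(** * Secant slopes of concave functions *)

(** Three-point concavity with denominators cleared, so that coinciding points need no separate
    treatment. *)
Definition concave01 (R : numDomainType) (phi : R -> R) :=
  forall x y z, 0 <= x -> x <= y -> y <= z -> z <= 1 ->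
    (z - y) * phi x + (y - x) * phi z <= (z - x) * phi y.

Lemma concave01_min (R : realDomainType) (phi psi : R -> R) :
  concave01 phi -> concave01 psi -> concave01 (fun t => Num.min (phi t) (psi t)).
Proof.
move=> cphi cpsi x y z x0 xy yz z1.
have {cphi}h1 := cphi x y z x0 xy yz z1; have {cpsi}h2 := cpsi x y z x0 xy yz z1.
have zy : 0 <= z - y by rewrite subr_ge0.
have yx : 0 <= y - x by rewrite subr_ge0.
have zx : 0 <= z - x by rewrite subr_ge0 (le_trans xy).
rewrite [leRHS]minr_pMr// le_min; apply/andP; split.
  by apply: le_trans h1; rewrite lerD// ler_wpM2l// ge_min lexx.
by apply: le_trans h2; rewrite lerD// ler_wpM2l// ge_min lexx orbT.
Qed.

Lemma concave01_linear (R : numDomainType) (c : R) : concave01 (fun t => c * t).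
Proof.
move=> x y z _ _ _ _; rewrite le_eqVlt; apply/orP; left; apply/eqP.
by ring.
Qed.

Section secant_slopes.
Variables (R : realFieldType) (phi : R -> R).
Hypothesis cphi : concave01 phi.

Definition slope (x y : R) := (phi x - phi y) / (x - y).

Lemma slopeC x y : slope x y = slope y x.
Proof. by rewrite /slope -(opprB y x) -(opprB (phi y)) invrN mulrNN. Qed.

(** The endpoints are moved one at a time, through [slope x y']; each move is an instance of
    three-point concavity. *)
Let slope_le_lt x y x' y' : 0 <= x -> x < y -> x' < y' -> y' <= 1 ->
  x <= x' -> y <= y' -> slope x' y' <= slope x y.
Proof.
move=> x0 xy xy' y1 xx yy.
apply: (@le_trans _ _ (slope x y')).
  rewrite slopeC (slopeC x) /slope ler_pdivrMr ?subr_gt0// mulrAC.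
  rewrite ler_pdivlMr ?subr_gt0 ?(le_lt_trans xx)//.
  by have := cphi x0 xx (ltW xy') y1; lra.
rewrite slopeC (slopeC x) /slope ler_pdivrMr ?subr_gt0 ?(lt_le_trans xy)// mulrAC.
rewrite ler_pdivlMr ?subr_gt0//.
by have := cphi x0 (ltW xy) yy y1; lra.
Qed.

(** The two pairs may be ordered oppositely: if x < y and y' < x', then x <= y' and y <= x', so the
    ordered case applies after swapping one pair. *)
Lemma slope_le x y x' y' : 0 <= x -> 0 <= y -> x' <= 1 -> y' <= 1 ->
  x != y -> x' != y' -> x <= x' -> y <= y' -> slope x' y' <= slope x y.
Proof.
move=> x0 y0 x1 y1; rewrite !neq_lt => /orP[] xy /orP[] xy' xx yy.
- exact: slope_le_lt.
- rewrite (slopeC x'); apply: slope_le_lt => //; first exact: le_trans (ltW xy) yy.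
  exact: le_trans yy (ltW xy').
- rewrite (slopeC x); apply: slope_le_lt => //; first exact: le_trans (ltW xy) xx.
  exact: le_trans xx (ltW xy').
- by rewrite slopeC (slopeC x); apply: slope_le_lt.
Qed.

Variable kappa : R.
Hypothesis phi_incr : forall x y, 0 <= x -> x <= y -> y <= 1 -> phi x <= phi y.
Hypothesis phi0 : phi 0 = 0.
Hypothesis phi_le : forall t, 0 <= t <= 1 -> phi t <= kappa * t.

Let slope_bound x y : 0 <= x <= 1 -> 0 <= y <= 1 -> x != y -> 0 <= slope x y <= kappa.
Proof.
wlog xy : x y / x < y.
  move=> h x01 y01 xy; have /orP[yx|yx] : (x < y) || (y < x) by rewrite -neq_lt.
    exact: h.
  by rewrite slopeC; apply: h => //; rewrite eq_sym.
move=> /andP[x0 x1] /andP[y0 y1] xNy; apply/andP; split.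
  by rewrite slopeC divr_ge0// subr_ge0 ?(ltW xy)// phi_incr// ltW.
have y_gt0 : 0 < y := le_lt_trans x0 xy.
(* Moving the left endpoint down to 0 can only steepen the secant, whose slope is then
   [phi y / y]. *)
apply: (@le_trans _ _ (slope 0 y)).
  by apply: slope_le => //; rewrite eq_sym gt_eqF.
by rewrite slopeC /slope phi0 !subr0 ler_pdivrMr// phi_le// y0.
Qed.

Variables a b : nat -> R.
Hypothesis a01 : forall i, 0 <= a i <= 1.
Hypothesis b01 : forall i, 0 <= b i <= 1.
Hypothesis a_incr : {homo a : i j / (i <= j)%N >-> i <= j}.
Hypothesis b_incr : {homo b : i j / (i <= j)%N >-> i <= j}.

(* The secant slope at (a i, b i) is meaningless when a i = b i; the previous
   slope is kept there, which preserves monotonicity. *)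
Let w := fix w i : R :=
  let p := if i is i'.+1 then w i' else kappa in
  if a i == b i then p else slope (a i) (b i).

(** Since slopes can be carried over many indices, monotonicity is proved against the index [j]
    where the current slope was last computed. *)
Let w_cases i : w i = kappa \/
  exists j, [/\ (j <= i)%N, a j != b j & w i = slope (a j) (b j)].
Proof.
elim: i => [|i IH] /=; case: ifPn => ab; [by left| | |]; last 2 first.
- case: IH => [->|[j [ji abj wj]]]; first by left.
  by right; exists j; split => //; rewrite (leq_trans ji).
- by right; exists i.+1.
- by right; exists 0%N.
Qed.

Let w_bound i : 0 <= kappa -> 0 <= w i <= kappa.
Proof.
move=> k0; have [->|[j [_ abj ->]]] := w_cases i; first by rewrite k0 lexx.
exact: slope_bound.
Qed.

Let w_decr i : w i.+1 <= w i.
Proof.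
rewrite [leLHS]/=; case: ifPn => // ab.
have [->|[j [ji abj ->]]] := w_cases i.
  by have /andP[] := slope_bound (a01 i.+1) (b01 i.+1) ab.
apply: slope_le => //.
- by have /andP[] := a01 j.
- by have /andP[] := b01 j.
- by have /andP[] := a01 i.+1.
- by have /andP[] := b01 i.+1.
- by rewrite a_incr// (leq_trans ji).
- by rewrite b_incr// (leq_trans ji).
Qed.

Lemma concave_sum_le n (E : R) :
  (forall k, (k <= n)%N -> `|\sum_(i < k) (a i - b i)| <= E) ->
  `|\sum_(i < n) (phi (a i) - phi (b i))| <= kappa * E.
Proof.
have k0 : 0 <= kappa.
  have := @phi_incr 0 1; have := @phi_le 1; rewrite phi0 lexx ler01 mulr1.
  by move=> /(_ isT) h1 h2; apply: le_trans (h2 _ _ _) h1.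
case: n => [|n] cE.
  by have := cE 0%N isT; rewrite !big_ord0 normr0 => E0; rewrite mulr_ge0.
have -> : \sum_(i < n.+1) (phi (a i) - phi (b i)) = \sum_(i < n.+1) w i * (a i - b i).
  apply: eq_bigr => i _; case: i => -[|i] _ /=; case: ifPn => [/eqP->|ab].
  - by rewrite !subrr mulr0.
  - by rewrite /slope divfK// subr_eq0.
  - by rewrite !subrr mulr0.
  - by rewrite /slope divfK// subr_eq0.
rewrite (abel_sum w (fun i => a i - b i)).
have E0 : 0 <= E by exact: le_trans (cE 0%N isT).
(* The Abel coefficients [w n] and [w j - w j.+1] are non-negative and telescope to [w 0], which is
   at most [kappa]. *)
apply: (@le_trans _ _ (w n * E + \sum_(j < n) (w j - w j.+1) * E)).
  rewrite (le_trans (ler_normD _ _))// lerD//.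
    rewrite normrM ger0_norm; last by have /andP[] := w_bound n k0.
    by rewrite ler_wpM2l ?cE//; have /andP[] := w_bound n k0.
  rewrite (le_trans (ler_norm_sum _ _ _))// ler_sum// => j _.
  rewrite normrM ger0_norm ?subr_ge0 ?w_decr// ler_wpM2l ?subr_ge0 ?w_decr//.
  by rewrite cE// ltnW// ltnS.
rewrite -mulr_suml -mulrDl ler_wpM2r//.
rewrite -[X in _ + X]opprK -sumrN (eq_bigr (fun j : 'I_n => w j.+1 - w j)); last first.
  by move=> i _; rewrite opprB.
rewrite -(big_mkord xpredT (fun j => w j.+1 - w j)) telescope_sumr//.
by rewrite opprB addrC subrK; have /andP[] := w_bound 0 k0.
Qed.
End secant_slopes.

(** * The iterated Lebesgue measure and Borel sets of the cube *)

Lemma open_borel_rV (R : realType) d (A : set (borel_rV R d)) :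
  @open 'rV[R]_d A -> measurable A.
Proof. by move=> oA; apply: sub_sigma_algebra. Qed.

Lemma closed_borel_rV (R : realType) d (A : set (borel_rV R d)) :
  @closed 'rV[R]_d A -> measurable A.
Proof.
move=> cA; rewrite -(setCK A); apply: measurableC; apply: open_borel_rV.
exact: closed_openC.
Qed.

Lemma measurable_coord_le (R : realType) d (i : 'I_d) (a : R) :
  measurable ([set x | a <= (x : 'rV[R]_d) 0 i] : set (borel_rV R d)).
Proof.
apply: closed_borel_rV.
apply: (@preimage_closed _ _ (fun x : 'rV[R]_d => x 0 i) [set t | a <= t]).
  by move=> x _; exact: coord_continuous.
exact: closed_ge.
Qed.

Lemma measurable_coord_lt (R : realType) d (i : 'I_d) (a : R) :
  measurable ([set x | (x : 'rV[R]_d) 0 i < a] : set (borel_rV R d)).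
Proof.
apply: open_borel_rV.
apply: (@open_comp _ _ (fun x : 'rV[R]_d => x 0 i) [set t | t < a]).
  by move=> x _; exact: coord_continuous.
exact: open_lt.
Qed.

Lemma measurable_corner_box (R : realType) d (xi : 'rV[R]_d) :
  measurable (corner_box xi : set (borel_rV R d)).
Proof.
have -> : corner_box xi = \bigcap_(i in [set: 'I_d])
    ([set x | 0 <= (x : 'rV[R]_d) 0 i] `&` [set x | (x : 'rV[R]_d) 0 i < xi 0 i]).
  apply/seteqP; split => [x xx i _|x xx i]; first by have /andP[] := xx i.
  by apply/andP; have [] := xx i I.
apply: fin_bigcap_measurable => // i _.
by apply: measurableI; [exact: measurable_coord_le|exact: measurable_coord_lt].
Qed.

Lemma closed_cube (R : realType) d : closed (@cube R d).
Proof.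
have -> : @cube R d = \bigcap_(i in [set: 'I_d]) ((fun x : 'rV[R]_d => x 0 i) @^-1` `[0, 1]).
  apply/seteqP; split => [x xx i _|x xx i]; first by rewrite /= in_itv/=; exact: xx.
  by have := xx i I; rewrite /= in_itv.
apply: closed_bigI => i _; apply: preimage_closed.
  by move=> x _; exact: coord_continuous.
exact: itv_closed.
Qed.

Lemma compact_cube (R : realType) d : compact (@cube R d).
Proof.
have := @rV_compact R d (fun=> `[0, 1]%classic) (fun=> @segment_compact R 0 1).
congr (compact _); apply/seteqP; split => x xx i; have := xx i; rewrite /= in_itv/=; exact.
Qed.

Lemma leb_set0 (R : realType) d : leb (set0 : set 'rV[R]_d) = 0%E.
Proof.
elim: d => [|d IHd] /=; first by rewrite indic0.
rewrite -[RHS](@integral0 _ _ _ (@lebesgue_measure R) setT).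
by apply: eq_integral => x _; rewrite -[RHS]IHd; congr leb.
Qed.

Lemma row_mx_scalar0 (R : pzRingType) d (x : R) (v : 'rV[R]_d) :
  (row_mx x%:M v : 'rV_d.+1) 0 ord0 = x.
Proof.
have -> : ord0 = lshift d (0 : 'I_1) :> 'I_(1 + d) by exact: val_inj.
by rewrite (@row_mxEl _ 1 1 d) mxE eqxx mulr1n.
Qed.

Lemma row_mx_scalar_lift (R : pzRingType) d (x : R) (v : 'rV[R]_d) (i : 'I_d) :
  (row_mx x%:M v : 'rV_d.+1) 0 (lift ord0 i) = v 0 i.
Proof.
have -> : lift ord0 i = rshift 1 i :> 'I_(1 + d) by exact: val_inj.
by rewrite (@row_mxEr _ 1 1 d).
Qed.

(** Non-negative sides matter: with two negative sides the box is empty while the product may be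
    positive. *)
Lemma leb_corner_box (R : realType) d (xi : 'rV[R]_d) : (forall i, 0 <= xi 0 i) ->
  leb (corner_box xi) = (\prod_i xi 0 i)%:E.
Proof.
elim: d xi => [|d IHd] xi xi0 /=.
  by rewrite big_ord0 indicE mem_set// => -[].
(* A slice at [x] is the box of the remaining sides or empty, so the inner measure is an indicator
   times a constant. *)
have E x : leb [set v | corner_box xi (row_mx x%:M v : 'rV_(1 + d))] =
    ((\1_(`[0, xi 0 0[%classic : set R) x)%:E * (\prod_(i < d) xi 0 (lift 0 i))%:E)%E.
  have [x01|x01] := boolP (x \in `[0, xi 0 0[).
    rewrite indicE mem_set//= mul1e.
    have -> : [set v | corner_box xi (row_mx x%:M v : 'rV_(1 + d))] =
        corner_box (\row_i xi 0 (lift 0 i)).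
      apply/seteqP; split => [v /= vxi i|v /= vxi i].
        by have := vxi (lift ord0 i); rewrite row_mx_scalar_lift mxE.
      have [j ->|->] := unliftP ord0 i; last by rewrite row_mx_scalar0.
      by rewrite row_mx_scalar_lift; have := vxi j; rewrite mxE.
    rewrite IHd; last by move=> i; rewrite mxE.
    by congr EFin; apply: eq_bigr => i _; rewrite mxE.
  rewrite indicE memNset; last exact/negP.
  rewrite mulr0n mul0e -[RHS](@leb_set0 R d); congr leb.
  apply/seteqP; split => // v /= /(_ ord0); rewrite row_mx_scalar0 => h.
  by move: x01; rewrite in_itv/= h.
under eq_integral do rewrite E.
rewrite integralZr//=; last first.
  exact: integrable_indic_itv.
rewrite integral_indic// setIT.
rewrite [X in (X * _)%E](_ : _ = (xi 0 0)%:E); last first.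
  apply: etrans (lebesgue_measure_itv `[0, xi 0 0[) _; rewrite /= lte_fin.
  case: ltP => [|h]; rewrite -?EFinB ?subr0//; congr EFin; apply/eqP.
  by rewrite eq_le h xi0.
by rewrite -EFinM big_ord_recl.
Qed.

(** Continuity holds only within the cube, so the superlevel set is the trace on the closed cube of
    some open set [V]. *)
Lemma measurable_superlevel (R : realType) d (f : 'rV[R]_d -> R) (s : R) :
  {within @cube R d, continuous f} ->
  measurable (@cube R d `&` [set x | s < f x] : set (borel_rV R d)).
Proof.
move=> cf.
have : open ((f : subspace (@cube R d) -> R) @^-1` [set t | s < t]).
  move/continuousP : cf => /(_ [set t | s < t]); apply; exact: open_gt.
move=> /open_subspaceP[V oV VE].
rewrite setIC -[X in X `&` _]/(f @^-1` [set t | s < t]) -VE.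
by apply: measurableI; [exact: open_borel_rV|exact: (closed_borel_rV (@closed_cube R d))].
Qed.

(** * Proinov's inequality *)

Section max_norm.
Variables (R : realType) (d : nat).
Implicit Types (x y v : 'rV[R]_d).

Lemma norm_le_coord v r : 0 <= r -> (forall i, `|v 0 i| <= r) -> `|v| <= r.
Proof.
move=> r0 vr; rewrite [leLHS]/Num.norm/= mx_normrE; apply/bigmax_leP; split => // -[j i] _ /=.
by rewrite ord1.
Qed.

Lemma cube_segment x y t : cube x -> cube y -> 0 <= t <= 1 -> cube (x + t *: (y - x)).
Proof.
move=> cx cy /andP[t0 t1] i; rewrite !mxE.
have /andP[x0 x1] := cx i; have /andP[y0 y1] := cy i.
have -> : x 0 i + t * (y 0 i - x 0 i) = (1 - t) * x 0 i + t * y 0 i by ring.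
apply/andP; split; first by rewrite addr_ge0 ?mulr_ge0 ?subr_ge0.
rewrite [leRHS](_ : 1 = (1 - t) * 1 + t * 1); last by ring.
by rewrite lerD// ler_wpM2l// subr_ge0.
Qed.

Variables (F : 'rV[R]_d -> R) (w delta : R).
Hypothesis delta0 : 0 < delta.
Hypothesis Fw : forall x y, cube x -> cube y -> `|x - y| <= delta -> `|F x - F y| <= w.

(** The segment from [x] to [y] is cut into [K + 1] equal steps, [K] being the integer part of |x -
    y| / delta. Each step is no longer than [delta] and costs at most [w]. *)
Lemma modulus_chain x y : cube x -> cube y ->
  `|F x - F y| <= w + w / delta * `|x - y|.
Proof.
move=> cx cy.
have w0 : 0 <= w.
  by have := Fw cx cx; rewrite !subrr !normr0; apply; exact: ltW.
pose K := Num.truncn (`|x - y| / delta).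
have /andP[K1 K2] : K%:R <= `|x - y| / delta < K.+1%:R.
  by apply: truncn_itv; rewrite divr_ge0// ltW.
pose z (j : nat) := x + (j%:R / K.+1%:R) *: (y - x).
have cz j : (j <= K.+1)%N -> cube (z j).
  move=> jK; apply: cube_segment => //.
  by rewrite divr_ge0//= ler_pdivrMr ?ltr0n// mul1r ler_nat.
have step j : (j < K.+1)%N -> `|F (z j) - F (z j.+1)| <= w.
  move=> jK; apply: Fw; [exact/cz/ltnW|exact: cz|].
  have -> : z j - z j.+1 = - (K.+1%:R^-1 *: (y - x)).
    rewrite /z opprD addrACA subrr add0r -scalerBl -[in RHS]scaleNr; congr (_ *: _).
    by rewrite -(natr1 j) mulrDl mul1r; ring.
  rewrite normrN normrZ distrC ger0_norm ?invr_ge0// mulrC ler_pdivrMr ?ltr0n//.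
  by rewrite mulrC -ler_pdivrMr// ltW.
have E0 : z 0%N = x by rewrite /z mul0r scale0r addr0.
have E1 : z K.+1 = y by rewrite /z divff// scale1r addrC subrK.
have chain j : (j <= K.+1)%N -> `|F (z 0%N) - F (z j)| <= j%:R * w.
  elim: j => [|j IHj] jK; first by rewrite subrr normr0 mul0r.
  have -> : F (z 0%N) - F (z j.+1) = (F (z 0%N) - F (z j)) + (F (z j) - F (z j.+1)) by ring.
  by rewrite (le_trans (ler_normD _ _))// -natr1 mulrDl mul1r lerD ?step ?IHj// ltnW.
rewrite -{1}E0 -{1}E1 (le_trans (chain _ (leqnn _)))// -natr1 mulrDl mul1r addrC lerD2l.
by rewrite mulrAC -mulrA mulrC ler_wpM2l.
Qed.

Variable B : R.
Hypothesis FB : forall x, cube x -> `|F x| <= B.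

(** On the cube the infimal convolution lies between [F - w] and [F]; adding [w / 2] centres it. It
    is defined at every point [c], which later allows samples at arbitrary multi-indices. *)
Definition lip_envelope (c : 'rV[R]_d) : R :=
  w / 2 + inf [set F y + w / delta * `|c - y| | y in @cube R d].

Let cube0 : @cube R d 0.
Proof. by move=> i; rewrite mxE lexx ler01. Qed.

Let w0 : 0 <= w.
Proof. by have := Fw cube0 cube0; rewrite !subrr !normr0; apply; exact: ltW. Qed.

Let L0 : 0 <= w / delta.
Proof. by rewrite divr_ge0// ltW. Qed.

Let env_has_inf c : has_inf [set F y + w / delta * `|c - y| | y in @cube R d].
Proof.
split; first by exists (F 0 + w / delta * `|c - 0|), 0.
exists (- B) => _ [y cy <-].
have := FB cy; rewrite ler_norml => /andP[h _].
by rewrite (le_trans h)// lerDl mulr_ge0.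
Qed.

Lemma lip_envelope_near x c : cube x ->
  `|F x - lip_envelope c| <= w / 2 + w / delta * `|x - c|.
Proof.
move=> cx; rewrite ler_norml; apply/andP; split.
  have h : inf [set F y + w / delta * `|c - y| | y in @cube R d] <= F x + w / delta * `|x - c|.
    by apply: ge_inf; [case: (env_has_inf c)|exists x => //; rewrite distrC].
  by rewrite /lip_envelope; lra.
(* The lower bound combines the chain estimate between [x] and [y] with the triangle inequality
   through [c]. *)
have h : F x - w - w / delta * `|x - c| <=
    inf [set F y + w / delta * `|c - y| | y in @cube R d].
  apply: lb_le_inf; first by case: (env_has_inf c).
  move=> _ [y cy <-].
  have := modulus_chain cx cy; rewrite ler_norml => /andP[_ h1].
  have h2 : w / delta * `|x - y| <= w / delta * `|x - c| + w / delta * `|c - y|.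
    by rewrite -mulrDr ler_wpM2l//; exact: ler_distD.
  lra.
by rewrite /lip_envelope; lra.
Qed.

Lemma lip_envelope_lip c c' :
  `|lip_envelope c - lip_envelope c'| <= w / delta * `|c - c'|.
Proof.
have h a b : inf [set F y + w / delta * `|a - y| | y in @cube R d] - w / delta * `|a - b| <=
    inf [set F y + w / delta * `|b - y| | y in @cube R d].
  apply: lb_le_inf; first by case: (env_has_inf b).
  move=> _ [y cy <-]; rewrite lerBlDr.
  apply: (@le_trans _ _ (F y + w / delta * `|a - y|)).
    by apply: ge_inf; [case: (env_has_inf a)|exists y].
  rewrite -addrA lerD2l -mulrDr ler_wpM2l// [leRHS]addrC; exact: ler_distD.
have h1 := h c c'; have h2 := h c' c; rewrite distrC in h2.
by rewrite ler_norml /lip_envelope; apply/andP; split; lra.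
Qed.

End max_norm.

(** * Means: normalized positive linear functionals carried by the cube *)

Section bounded_measurable.
Variables (R : realType) (d : nat).
Implicit Types F G : 'rV[R]_d -> R.

Definition bounded_borel F :=
  measurable_fun [set: borel_rV R d] (F : borel_rV R d -> R) /\
  exists B, forall x, cube x -> `|F x| <= B.

Lemma bounded_borel_cst c : bounded_borel (fun=> c).
Proof. by split; [exact: measurable_cst|exists `|c|]. Qed.

Lemma bounded_borelD F G :
  bounded_borel F -> bounded_borel G -> bounded_borel (fun x => F x + G x).
Proof.
move=> [mF [B FB]] [mG [C GC]]; split; first exact: measurable_funD.
by exists (B + C) => x cx; rewrite (le_trans (ler_normD _ _))// lerD ?FB ?GC.
Qed.

Lemma bounded_borelM F G :
  bounded_borel F -> bounded_borel G -> bounded_borel (fun x => F x * G x).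
Proof.
move=> [mF [B FB]] [mG [C GC]]; split; first exact: measurable_funM.
by exists (B * C) => x cx; rewrite normrM ler_pM ?FB ?GC.
Qed.

Lemma bounded_borelZ c F : bounded_borel F -> bounded_borel (fun x => c * F x).
Proof. by move=> bF; apply: bounded_borelM => //; exact: bounded_borel_cst. Qed.

Lemma bounded_borelB F G :
  bounded_borel F -> bounded_borel G -> bounded_borel (fun x => F x - G x).
Proof.
move=> bF bG; rewrite (_ : (fun x => _) = (fun x => F x + -1 * G x)).
  by apply: bounded_borelD => //; exact: bounded_borelZ.
by apply/funext => x; rewrite mulN1r.
Qed.

Lemma bounded_borel_indic (A : set 'rV[R]_d) :
  measurable (A : set (borel_rV R d)) -> bounded_borel (\1_A).
Proof.
move=> mA; split; first exact: measurable_indic.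
by exists 1 => x _; rewrite indicE; case: (_ \in _); rewrite ?normr1 ?normr0.
Qed.

Lemma bounded_borel_sum (I : Type) (r : seq I) (H : I -> 'rV[R]_d -> R) :
  (forall i, bounded_borel (H i)) -> bounded_borel (fun x => \sum_(i <- r) H i x).
Proof.
move=> bH; elim: r => [|i r IH].
  rewrite (_ : (fun x => _) = (fun=> 0)); first exact: bounded_borel_cst.
  by apply/funext => x; rewrite big_nil.
rewrite (_ : (fun x => _) = (fun x => H i x + \sum_(i <- r) H i x)).
  exact: bounded_borelD.
by apply/funext => x; rewrite big_cons.
Qed.

(** This covers the law of [U] and the empirical measure at once. Monotonicity is tested on the cube
    only, which suffices because both are carried by it. *)
Record mean (L : ('rV[R]_d -> R) -> R) : Prop := Mean {
  mean1 : L (fun=> 1) = 1;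
  meanD : forall F G, bounded_borel F -> bounded_borel G ->
    L (fun x => F x + G x) = L F + L G;
  meanZ : forall c F, bounded_borel F -> L (fun x => c * F x) = c * L F;
  le_mean : forall F G, bounded_borel F -> bounded_borel G ->
    (forall x, cube x -> F x <= G x) -> L F <= L G }.

Section mean_theory.
Variable L : ('rV[R]_d -> R) -> R.
Hypothesis mL : mean L.

Lemma mean_cst c : L (fun=> c) = c.
Proof.
by have := meanZ mL c (bounded_borel_cst 1); rewrite (mean1 mL) mulr1.
Qed.

Lemma meanB F G : bounded_borel F -> bounded_borel G ->
  L (fun x => F x - G x) = L F - L G.
Proof.
move=> bF bG; rewrite (_ : (fun x => _) = (fun x => F x + -1 * G x)).
  by rewrite (meanD mL)// ?(meanZ mL)// ?mulN1r//; exact: bounded_borelZ.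
by apply/funext => x; rewrite mulN1r.
Qed.

Lemma mean_sum (I : Type) (r : seq I) (H : I -> 'rV[R]_d -> R) :
  (forall i, bounded_borel (H i)) ->
  L (fun x => \sum_(i <- r) H i x) = \sum_(i <- r) L (H i).
Proof.
move=> bH; elim: r => [|i r IH].
  rewrite big_nil -[RHS](mean_cst 0); congr L.
  by apply/funext => x; rewrite big_nil.
rewrite big_cons -IH -(meanD mL)//; last exact: bounded_borel_sum.
by congr L; apply/funext => x; rewrite big_cons.
Qed.

Lemma norm_mean_le F G : bounded_borel F -> bounded_borel G ->
  (forall x, cube x -> `|F x| <= G x) -> `|L F| <= L G.
Proof.
move=> bF bG FG; rewrite ler_norml; apply/andP; split.
  rewrite -mulN1r -(meanZ mL)//; apply: (le_mean mL) => //; first exact: bounded_borelZ.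
  by move=> x cx; rewrite mulN1r; have := FG _ cx; rewrite ler_norml => /andP[].
apply: (le_mean mL) => // x cx.
by have := FG _ cx; rewrite ler_norml => /andP[].
Qed.
End mean_theory.
End bounded_measurable.

Lemma all2_leqP s t : size s = size t ->
  reflect (forall i, (i < size s)%N -> (nth 0 s i <= nth 0 t i)%N) (all2 leq s t).
Proof.
elim: s t => [|i s IH] [|j t]//= st; first by apply: ReflectT.
apply: (iffP andP) => [[ij /(IH _ (succn_inj st)) h] [|k]|h]; [by []|exact: h|].
by split; [exact: (h 0%N)|apply/(IH _ (succn_inj st)) => k; exact: (h k.+1)].
Qed.

(** * Half-open cells of the regular grid on the cube *)

Section cells.
Variables (R : realType) (d m : nat).
Local Notation M := (m.+1%:R : R).

Definition unit_box : set 'rV[R]_d := corner_box (const_mx 1).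

Definition cell_index (x : 'rV[R]_d) : seq nat :=
  [seq Num.truncn (M * x 0 i) | i <- enum 'I_d].

Lemma nth_cell_index x (i : 'I_d) : nth 0%N (cell_index x) i = Num.truncn (M * x 0 i).
Proof. by rewrite (nth_map i) ?size_enum_ord// nth_ord_enum. Qed.

Definition cell (k : seq nat) : set 'rV[R]_d := unit_box `&` [set x | cell_index x = k].

Lemma unit_boxP x : unit_box x <-> forall i, 0 <= x 0 i < 1.
Proof. by split => h i; have := h i; rewrite mxE. Qed.

Lemma unit_box_cube x : unit_box x -> cube x.
Proof. by move=> /unit_boxP h i; have /andP[-> /ltW ->] := h i. Qed.

Lemma cell_index_grid x : unit_box x -> cell_index x \in grid m.+1 d.
Proof.
move=> /unit_boxP xQ; rewrite mem_grid size_map size_enum_ord eqxx/=.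
apply/allP => _ /mapP[i _ ->]; have /andP[x0 x1] := xQ i.
rewrite -(ltr_nat R); apply: le_lt_trans (_ : _ <= M * x 0 i) _.
  by have /andP[] := @truncn_itv _ (M * x 0 i) (mulr_ge0 (ler0n _ _) x0).
by rewrite -[ltRHS]mulr1 ltr_pM2l ?ltr0n.
Qed.

Definition star_corner (l : seq nat) : 'rV[R]_d := \row_i ((nth 0%N l i).+1%:R / M).

Lemma star_corner_cube l : l \in grid m.+1 d -> cube (star_corner l).
Proof.
rewrite mem_grid => /andP[/eqP sl /allP al] i; rewrite mxE divr_ge0//=.
by rewrite ler_pdivrMr ?ltr0n// mul1r ler_nat; apply/al/mem_nth; rewrite sl.
Qed.

(** Boxes with a corner on the grid are unions of cells: x_i < (l_i + 1)/M exactly when the integer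
    part of M x_i is at most l_i. *)
Lemma star_cornerP l x : l \in grid m.+1 d ->
  corner_box (star_corner l) x <-> unit_box x /\ all2 leq (cell_index x) l.
Proof.
move=> lg; have : l \in grid m.+1 d by [].
rewrite mem_grid => /andP[/eqP sl _].
have trP (i : 'I_d) : 0 <= x 0 i ->
    (x 0 i < (nth 0%N l i).+1%:R / M) = (nth 0%N (cell_index x) i <= nth 0%N l i)%N.
  move=> x0; rewrite nth_cell_index -ltnS truncn_lt_nat ?mulr_ge0//.
  by rewrite ltr_pdivlMr ?ltr0n// mulrC.
have szE : size (cell_index x) = size l by rewrite size_map size_enum_ord sl.
split => [xl|[/unit_boxP xQ xl] i].
  have xl' i : 0 <= x 0 i /\ x 0 i < (nth 0%N l i).+1%:R / M.
    by have := xl i; rewrite mxE => /andP[].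
  split.
    apply/unit_boxP => i; have [-> xi] := xl' i; rewrite (lt_le_trans xi)//.
    by have /andP[] := star_corner_cube lg i; rewrite mxE.
  apply/(all2_leqP szE) => j; rewrite size_map size_enum_ord => jd.
  by have [x0 xi] := xl' (Ordinal jd); rewrite -(trP (Ordinal jd)).
have /andP[x0 _] := xQ i; rewrite x0 mxE trP//.
by move/(all2_leqP szE) : xl; apply; rewrite size_map size_enum_ord.
Qed.

Lemma measurable_cell k : measurable (cell k : set (borel_rV R d)).
Proof.
(* A list of the wrong length is never a cell index, and its cell is empty. *)
have [sk|sk] := eqVneq (size k) d; last first.
  rewrite (_ : cell k = set0)//; apply/seteqP; split => // x [_ /= xk].
  by move: sk; rewrite -xk size_map size_enum_ord eqxx.
have -> : cell k = unit_box `&` \bigcap_(i in [set: 'I_d])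
    ([set x | (nth 0%N k i)%:R / M <= (x : 'rV[R]_d) 0 i] `&`
     [set x | (x : 'rV[R]_d) 0 i < (nth 0%N k i).+1%:R / M]).
  have E (x : 'rV[R]_d) (i : 'I_d) : 0 <= x 0 i -> (nth 0%N (cell_index x) i == nth 0%N k i) =
      ((nth 0%N k i)%:R / M <= x 0 i) && (x 0 i < (nth 0%N k i).+1%:R / M).
    move=> x0; rewrite nth_cell_index truncn_eq ?mulr_ge0//.
    by rewrite ler_pdivrMr ?ltr0n// ltr_pdivlMr ?ltr0n// mulrC.
  apply/seteqP; split => x [xQ xk]; split => //.
    move=> i _; have /andP[x0 _] := (unit_boxP x).1 xQ i.
    by apply/andP; rewrite -E// xk.
  apply: (@eq_from_nth _ 0%N); first by rewrite size_map size_enum_ord.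
  rewrite size_map size_enum_ord => j jd; apply/eqP.
  have /andP[x0 _] := (unit_boxP x).1 xQ (Ordinal jd).
  by rewrite (E x (Ordinal jd))//; apply/andP; exact: xk.
apply: measurableI; first exact: measurable_corner_box.
apply: fin_bigcap_measurable => // i _.
by apply: measurableI; [exact: measurable_coord_le|exact: measurable_coord_lt].
Qed.

End cells.

(** * Comparison of two means on a fixed grid *)

Section quadrature.
Variables (R : realType) (d m : nat) (L1 L2 : ('rV[R]_d -> R) -> R) (D : R).
Hypotheses (mL1 : mean L1) (mL2 : mean L2).
Hypothesis discr : forall xi, cube xi ->
  `|L1 (\1_(corner_box xi)) - L2 (\1_(corner_box xi))| <= D.
Hypothesis L1_unit_box : L1 (\1_(@unit_box R d)) = 1.
Variables (F : 'rV[R]_d -> R) (w delta : R).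
Hypothesis bF : bounded_borel F.
Hypothesis delta0 : 0 < delta.
Hypothesis Fw : forall x y, cube x -> cube y -> `|x - y| <= delta -> `|F x - F y| <= w.

Local Notation M := (m.+1%:R : R).
Let M0 : 0 < M. Proof. by rewrite ltr0n. Qed.

Let FB : exists B, forall x, cube x -> `|F x| <= B. Proof. by case: bF. Qed.

Let cube0 : @cube R d 0.
Proof. by move=> i; rewrite mxE lexx ler01. Qed.

Let w0 : 0 <= w.
Proof. by have := Fw cube0 cube0; rewrite !subrr !normr0; apply; exact: ltW. Qed.

Let lip0 : 0 <= w / delta.
Proof. by rewrite divr_ge0// ltW. Qed.

Let center (k : seq nat) : 'rV[R]_d := \row_i (((nth 0%N k i)%:R + 2^-1) / M).
Let G k := lip_envelope F w delta (center k).
Let c := G (nseq d m).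
(** A point of the half-open cube is within 1/(2M) of the centre of its cell, which gives [a]. Any
    point of the cube is within 1 - 1/(2M) of the centre of the last cell, which gives [a + osc]. *)
Let a := w / 2 + w / delta / (2 * M).
Let osc := w / delta * (1 - M^-1).

Let near_cell x : unit_box x -> `|F x - G (cell_index m x)| <= a.
Proof.
move=> xQ; have [B FB'] := FB.
apply: le_trans (lip_envelope_near delta0 Fw FB' _ (unit_box_cube xQ)) _.
rewrite lerD2l ler_wpM2l//.
apply: norm_le_coord; first by rewrite invr_ge0 mulr_ge0// ltW.
move=> i; rewrite !mxE nth_cell_index.
have /andP[x0 _] := (unit_boxP x).1 xQ i.
have /andP[h1 h2] := @truncn_itv _ (M * x 0 i) (mulr_ge0 (ler0n _ _) x0).
move: h1 h2; rewrite -(natr1 (Num.truncn _)); move: (Num.truncn _)%:R => t h1 h2.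
have -> : x 0 i - (t + 2^-1) / M = (M * x 0 i - (t + 2^-1)) / M.
  by field; rewrite gt_eqF.
rewrite normrM [`|M^-1|]ger0_norm ?invr_ge0 ?ler0n// invfM ler_wpM2r ?invr_ge0 ?ler0n//.
by rewrite ler_norml; apply/andP; split; lra.
Qed.

(** At most one coordinate of the centre moves, by 1/M; if [size s] is at least [d], none does. *)
Let adjacent s i t : `|G (s ++ i :: t) - G (s ++ i.+1 :: t)| <= w / delta / M.
Proof.
have [B FB'] := FB.
apply: le_trans (lip_envelope_lip delta0 Fw FB' _ _) _.
rewrite ler_wpM2l//; apply: norm_le_coord; first by rewrite invr_ge0 ltW.
move=> j; rewrite !mxE -mulrBl normrM [`|M^-1|]ger0_norm ?invr_ge0 ?ler0n//.
rewrite -[leRHS]mul1r ler_wpM2r ?invr_ge0 ?ler0n//.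
rewrite !nth_cat; case: ifP => _; first by rewrite subrr normr0.
case: (j - size s)%N => [|k] /=; last by rewrite subrr normr0.
by rewrite -natr1 ler_norml; apply/andP; split; lra.
Qed.

Let near_last x : cube x -> `|F x - c| <= a + osc.
Proof.
move=> cx; have [B FB'] := FB.
apply: le_trans (lip_envelope_near delta0 Fw FB' _ cx) _.
have -> : a + osc = w / 2 + w / delta * (1 - (2 * M)^-1).
  by rewrite /a /osc; field; rewrite !gt_eqF.
rewrite lerD2l ler_wpM2l//.
have hM : (2 * M)^-1 <= 2^-1.
  by rewrite invfM ler_piMr// invf_le1// ler1n.
have lastE : (m%:R + 2^-1) / M = 1 - (2 * M)^-1.
  by rewrite -natr1; field; rewrite addrC natr1 gt_eqF.
have z0 : 0 <= (2 * M)^-1 by rewrite invr_ge0 mulr_ge0// ltW.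
move: (2 * M)^-1 hM lastE z0 => z hM lastE z0.
apply: norm_le_coord; first by lra.
move=> i; rewrite !mxE nth_nseq ltn_ord lastE.
have /andP[x0 x1] := cx i.
by rewrite ler_norml; apply/andP; split; lra.
Qed.

(** The step function of the samples, recentred at the last one so that [sum_grid_le] applies to the
    difference of its means. *)
Let S (x : 'rV[R]_d) : R := \sum_(k <- grid m.+1 d) (G k - c) * \1_(@cell R d m k) x.

Let bcell k : bounded_borel (\1_(@cell R d m k)).
Proof. by apply: bounded_borel_indic; exact: measurable_cell. Qed.

Let bbox (xi : 'rV[R]_d) : bounded_borel (\1_(corner_box xi)).
Proof. by apply: bounded_borel_indic; exact: measurable_corner_box. Qed.

Let indic_cell k x : \1_(@cell R d m k) x = \1_(@unit_box R d) x * (cell_index m x == k)%:R :> R.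
Proof.
rewrite !indicE -natrM mulnb; congr (nat_of_bool _)%:R.
by apply/idP/andP => [/set_mem[/= h1 /eqP h2]|[/set_mem h1 /eqP h2]];
  [rewrite mem_set|apply/mem_set].
Qed.

Let sum_cells (H : seq nat -> R) x :
  \sum_(k <- grid m.+1 d) H k * \1_(@cell R d m k) x = \1_(@unit_box R d) x * H (cell_index m x).
Proof.
under eq_bigr do rewrite indic_cell mulrCA.
rewrite -mulr_sumr; have [xQ|xQ] := pselect (unit_box x).
  by rewrite big_grid_indicator//; exact: cell_index_grid.
by rewrite indicE memNset// !mul0r.
Qed.

Let v k := L1 (\1_(@cell R d m k)) - L2 (\1_(@cell R d m k)).

Let mean_cells L (H : seq nat -> R) : mean L ->
  L (fun x => \sum_(k <- grid m.+1 d) H k * \1_(@cell R d m k) x) =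
  \sum_(k <- grid m.+1 d) H k * L (\1_(@cell R d m k)).
Proof.
move=> mL; rewrite (mean_sum mL); last by move=> k; exact: bounded_borelZ.
by apply: eq_bigr => k _; rewrite (meanZ mL).
Qed.

Let star_sum_v l : l \in grid m.+1 d -> `|star_sum m.+1 d v l| <= D.
Proof.
move=> lg; apply: le_trans (discr (star_corner_cube R lg)).
have E L : mean L -> L (\1_(corner_box (star_corner R d m l))) =
    \sum_(k <- grid m.+1 d) (all2 leq k l)%:R * L (\1_(@cell R d m k)).
  move=> mL; rewrite -mean_cells//; congr L; apply/funext => x.
  rewrite sum_cells !indicE -natrM mulnb; congr (nat_of_bool _)%:R.
  apply/idP/andP => [/set_mem/(star_cornerP _ lg)[h1 h2]|[/set_mem h1 h2]].
    by rewrite mem_set.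
  by apply/mem_set/(star_cornerP _ lg).
rewrite !E// -sumrB le_eqVlt; apply/orP; left; apply/eqP; congr `|_|.
by apply: eq_bigr => k _; rewrite /v mulrC mulrBr.
Qed.

Let bS : bounded_borel S.
Proof. by apply: bounded_borel_sum => k; exact: bounded_borelZ. Qed.

Let Q : 'rV[R]_d -> R := \1_(@unit_box R d).
Let bQ : bounded_borel Q. Proof. exact: bbox. Qed.

(* Corner boxes are half-open and miss the upper faces of the cube: T is the
   part of F on these faces, which L1 does not charge and to which L2 gives
   mass at most D. *)
Let A x := (F x - c) * Q x - S x.
Let T x := (F x - c) * (1 - Q x).

Let bFc : bounded_borel (fun x => F x - c).
Proof. by apply: bounded_borelB => //; exact: bounded_borel_cst. Qed.

Let bQC : bounded_borel (fun x => 1 - Q x).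
Proof. by apply: bounded_borelB => //; exact: bounded_borel_cst. Qed.

Let bA : bounded_borel A.
Proof. by apply: bounded_borelB => //; exact: bounded_borelM. Qed.

Let bT : bounded_borel T.
Proof. exact: bounded_borelM. Qed.

Let decomp L : mean L -> L F = c + L S + (L A + L T).
Proof.
move=> mL; rewrite -(meanD mL)// -{1}[c](mean_cst mL) -!(meanD mL)//.
- by congr L; apply/funext => x; rewrite /A /T; ring.
- by apply: bounded_borelD => //; exact: bounded_borel_cst.
- exact: bounded_borelD.
- exact: bounded_borel_cst.
Qed.

Let A_le L : mean L -> `|L A| <= a * L Q.
Proof.
move=> mL; rewrite -(meanZ mL)//; apply: (norm_mean_le mL) => //.
  exact: bounded_borelZ.
move=> x cx; rewrite /A /S sum_cells /Q indicE.
have [xQ|xQ] := pselect (unit_box x); last first.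
  by rewrite memNset// !mul0r !mulr0 subrr normr0.
rewrite mem_set// !mulr1 mul1r.
have -> : F x - c - (G (cell_index m x) - c) = F x - G (cell_index m x) by ring.
exact: near_cell.
Qed.

Let T_le L : mean L -> `|L T| <= (a + osc) * (1 - L Q).
Proof.
move=> mL; rewrite -{1}[1](mean_cst mL) -(meanB mL)//; last exact: bounded_borel_cst.
rewrite -(meanZ mL)//; apply: (norm_mean_le mL) => //.
  exact: bounded_borelZ.
move=> x cx; rewrite /T normrM [`|1 - _|]ger0_norm.
  by rewrite ler_wpM2r ?near_last// /Q indicE; case: (_ \in _); rewrite ?subrr ?subr0.
by rewrite /Q indicE; case: (_ \in _); rewrite ?subrr ?subr0.
Qed.

(** [S] contributes the grid bound. [A] and [T] together contribute [a] under [L1] and at most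
    [a + osc * D] under [L2], and [2 * a] is the leading w + (w / delta) / M. *)
Lemma quadrature_grid :
  `|L1 F - L2 F| <= w + w / delta / M
    + D * (w / delta) * (1 - M^-1 + ((2 * M - 1) ^+ d - 1) / (2 * M)).
Proof.
have dS : `|L1 S - L2 S| <= w / delta / M * D * ((2 * M - 1) ^+ d - 1) / 2.
  rewrite /S !mean_cells// -sumrB.
  under eq_bigr do rewrite -mulrBr.
  by apply: sum_grid_le => //; rewrite divr_ge0// ltW.
(* The half-open cube is itself a corner box, of full mass under [L1]. *)
have q2 : 1 - L2 Q <= D.
  have := @discr (const_mx 1); rewrite -/unit_box L1_unit_box => h.
  apply: le_trans (h _); first exact: ler_norm.
  by move=> i; rewrite mxE ler01 lexx.
have A1 := A_le mL1; have A2 := A_le mL2; have T1 := T_le mL1; have T2 := T_le mL2.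
move: A1 T1; rewrite /Q L1_unit_box -/Q subrr mulr0 mulr1 => A1 T1.
rewrite !decomp//.
have -> : c + L1 S + (L1 A + L1 T) - (c + L2 S + (L2 A + L2 T)) =
  (L1 S - L2 S) + (L1 A + L1 T - (L2 A + L2 T)) by ring.
rewrite (le_trans (ler_normD _ _))//.
have h : `|L1 A + L1 T - (L2 A + L2 T)| <= a + (a * L2 Q + (a + osc) * (1 - L2 Q)).
  rewrite (le_trans (ler_normB _ _))// lerD//.
    by rewrite (le_trans (ler_normD _ _))// -[leRHS]addr0 lerD.
  by rewrite (le_trans (ler_normD _ _))// lerD.
have osc0 : 0 <= osc by rewrite mulr_ge0// subr_ge0 invf_le1// ler1n.
have h2 : osc * (1 - L2 Q) <= osc * D by rewrite ler_wpM2l.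
apply: (@le_trans _ _ (w / delta / M * D * ((2 * M - 1) ^+ d - 1) / 2 + (2 * a + osc * D))).
  rewrite lerD// (le_trans h)//; lra.
rewrite le_eqVlt; apply/orP; left; apply/eqP; rewrite /a /osc.
by field; rewrite !gt_eqF.
Qed.

End quadrature.

(** The left-hand side is the bound of [quadrature_grid] for D = delta^d, without its first term [w]
    and divided by [w]; the value 3 thus leads to the constant 4. *)
Lemma grid_size_exists (R : realType) (d : nat) (delta : R) : (1 <= d)%N ->
  0 < delta -> delta <= 1 ->
  exists m : nat, let M : R := m.+1%:R in
    (delta * M)^-1 + delta ^+ d / delta * (1 - M^-1 + ((2 * M - 1) ^+ d - 1) / (2 * M)) <= 3.
Proof.
case: d => [//|d] _ d0 d1.
set x := delta^-1.
have x1 : 1 <= x by rewrite -invr1 lef_pV2 ?posrE.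
have dx : delta * x = 1 by rewrite mulfV// gt_eqF.
rewrite exprSr mulfK ?gt_eqF//.
case: d => [|d].
  (* In dimension one the quantity is (x + 2M - 2)/M, at most 3 as soon as x <= M + 2; here x <=
     M. *)
  exists (Num.truncn x) => M.
  have M0 : 0 < M by rewrite ltr0n.
  have xM : x <= M by have /andP[_ /ltW] := truncn_itv (le_trans ler01 x1).
  rewrite expr0 mul1r expr1 invfM -/x.
  have -> : x / M + (1 - M^-1 + (2 * M - 1 - 1) / (2 * M)) = (x + 2 * M - 2) / M.
    by field; rewrite gt_eqF.
  by rewrite ler_pdivrMr//; lra.
(* From dimension two on, [M] is taken with 2M - 1 <= x <= 2M + 1. *)
have h0 : 0 <= (x - 1) / 2 by lra.
have /andP[h1 h2] := truncn_itv h0.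
exists (Num.truncn ((x - 1) / 2)) => M.
have M1 : 1 <= M by rewrite ler1n.
have M0 : 0 < M by exact: lt_le_trans M1.
have h3 : 2 * M - 1 <= x by rewrite /M -natr1; lra.
have h4 : x <= 2 * M + 1 by rewrite /M; lra.
(* For M = 1 both sides of [key] vanish; for M >= 2 the term (2M - 1) - 2 is non-negative and can be
   compared separately. *)
have N1 : M = 1 \/ 2 <= M.
  rewrite /M; case: (Num.truncn _) => [|k]; first by left.
  by right; rewrite ler_nat.
move: M M1 M0 h3 h4 N1 {h0 h1 h2} => M M1 M0 h3 h4 N1.
(* The left-hand side of the bound decreases in d, so d = 2 is the worst case;
   with N = 2M - 1 and x = 1 / delta it amounts to (x - (N + 2)) (2x - (N - 1)) <= 0,
   which holds for N <= x <= N + 2. *)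
have key : delta ^+ d.+1 * ((2 * M - 1) ^+ d.+2 + (2 * M - 1) - 2) <=
    delta * ((2 * M - 1) ^+ 2 + (2 * M - 1) - 2).
  case: N1 => [->|M2].
    by rewrite (_ : 2 * 1 - 1 = 1 :> R) ?expr1n; [lra|ring].
  rewrite -!addrA !mulrDr lerD//.
    have -> : delta ^+ d.+1 * (2 * M + -1) ^+ d.+2 =
        delta * (2 * M - 1) ^+ 2 * (delta * (2 * M - 1)) ^+ d.
      by rewrite exprMn !exprS; ring.
    apply: ler_piMr; first by rewrite mulr_ge0 ?sqr_ge0// ltW.
    apply: exprn_ile1; last by rewrite -[leRHS]dx ler_pM2l.
    by rewrite mulr_ge0 ?(ltW d0)//; lra.
  rewrite -!mulrDr ler_wpM2r//; first by lra.
  by rewrite exprS ler_piMr ?(ltW d0)// exprn_ile1// ltW.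
have -> : (delta * M)^-1 = 2 * x / (2 * M).
  by rewrite /x; field; rewrite !gt_eqF.
have -> : 2 * x / (2 * M) + delta ^+ d.+1 *
    (1 - M^-1 + ((2 * M - 1) ^+ d.+2 - 1) / (2 * M)) =
    (2 * x + delta ^+ d.+1 * ((2 * M - 1) ^+ d.+2 + (2 * M - 1) - 2)) / (2 * M).
  by field; rewrite gt_eqF.
rewrite ler_pdivrMr ?mulr_gt0//.
apply: (@le_trans _ _ (2 * x + delta * ((2 * M - 1) ^+ 2 + (2 * M - 1) - 2))).
  by rewrite lerD2l.
rewrite -(ler_pM2l (lt_le_trans ltr01 x1)).
rewrite [leLHS](_ : _ = 2 * x * x + delta * x * ((2 * M - 1) ^+ 2 + (2 * M - 1) - 2)); last by ring.
rewrite dx mul1r.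
have : (x - (2 * M + 1)) * (2 * x - (2 * M - 2)) <= 0.
  by rewrite mulr_le0_ge0//; lra.
by rewrite expr2; nra.
Qed.

Lemma proinov_inequality (R : realType) (d : nat) (L1 L2 : ('rV[R]_d -> R) -> R)
    (F : 'rV[R]_d -> R) (w delta : R) :
  (1 <= d)%N -> 0 < delta -> delta <= 1 -> mean L1 -> mean L2 ->
  (forall xi, cube xi ->
    `|L1 (\1_(corner_box xi)) - L2 (\1_(corner_box xi))| <= delta ^+ d) ->
  L1 (\1_(@unit_box R d)) = 1 ->
  bounded_borel F ->
  (forall x y, cube x -> cube y -> `|x - y| <= delta -> `|F x - F y| <= w) ->
  `|L1 F - L2 F| <= 4 * w.
Proof.
move=> d1 d0 dl1 mL1 mL2 discr L1Q bF Fw.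
have w0 : 0 <= w.
  have c0 : @cube R d 0 by move=> i; rewrite mxE lexx ler01.
  by have := Fw _ _ c0 c0; rewrite !subrr !normr0; apply; exact: ltW.
have [m /= hm] := grid_size_exists d1 d0 dl1.
apply: le_trans (quadrature_grid m mL1 mL2 discr L1Q bF d0 Fw) _.
have := ler_wpM2l w0 hm; rewrite invfM.
move: (1 - _ + _) => q h.
have -> : delta ^+ d * (w / delta) * q = w * (delta ^+ d / delta * q) by ring.
have -> : w / delta / m.+1%:R = w * (delta^-1 / m.+1%:R) by ring.
move: h; rewrite mulrDr; move: (w * (delta^-1 / _)) (w * (_ * q)) => p r; lra.
Qed.

(** * Riemann sums of Choquet integrals *)

Section riemann_sums.
Variables (R : realType) (g : R -> R).
Hypothesis g_decr : {homo g : x y /~ x <= y}.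
Local Notation mu := (@lebesgue_measure R).

Let mu_itv_lty (b1 b2 : bool) (a b : R) :
  (mu [set` Interval (BSide b1 a) (BSide b2 b)] < +oo)%E.
Proof. by rewrite lebesgue_measure_itv/=; case: ifP => _; rewrite -?EFinB ltry. Qed.

Let g_integrable a b : mu.-integrable `[a, b]%classic (EFin \o g).
Proof.
apply: measurable_bounded_integrable => //.
- exact: mu_itv_lty.
- by apply: nonincreasing_measurable => // x y xy; exact: g_decr.
exists (`|g a| + `|g b|); split; first by rewrite num_real.
move=> B hB x; rewrite /= in_itv/= => /andP[ax xb].
have h1 := g_decr ax; have h2 := g_decr xb.
have h3 := ler_norm (g a); have h4 := ler_norm (- g b); rewrite normrN in h4.
have h5 := normr_ge0 (g a); have h6 := normr_ge0 (g b).
by rewrite ler_norml; apply/andP; split; lra.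
Qed.

Lemma riemann_sum_bounds alpha h N : 0 <= h ->
  h * \sum_(i < N) g (alpha + i.+1%:R * h) <=
    \int[mu]_(x in `[alpha, alpha + N%:R * h]) g x <=
  h * \sum_(i < N) g (alpha + i%:R * h).
Proof.
move=> h0; elim: N => [|N IHN].
  by rewrite !big_ord0 !mulr0 mul0r addr0 set_itv1 Rintegral_set1 lexx.
set p := alpha + N%:R * h; set q := alpha + N.+1%:R * h.
have qE : q = p + h by rewrite /q /p -natr1; ring.
have ap : alpha <= p by rewrite lerDl mulr_ge0.
have pq : p <= q by rewrite qE lerDl.
have piece : h * g q <= \int[mu]_(x in `]p, q]) g x <= h * g p.
  have int_cstE c : \int[mu]_(x in `]p, q]) c = h * c.
    rewrite Rintegral_cst// mulrC; congr (_ * _).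
    apply: etrans (congr1 fine (lebesgue_measure_itv `]p, q])) _.
    rewrite /= lte_fin; case: ltP => [_|qp]; first by rewrite -EFinB/= qE; ring.
    by move: qp; rewrite qE /=; lra.
  have int_cst c : mu.-integrable `]p, q]%classic (EFin \o cst c).
    apply: measurable_bounded_integrable => //; last exact: bounded_cst.
    exact: mu_itv_lty.
  have int_g : mu.-integrable `]p, q]%classic (EFin \o g).
    apply: integrableS (g_integrable p q) => //.
    exact: subset_itv_oc_cc.
  rewrite -!int_cstE; apply/andP; split; apply: le_Rintegral => //;
    [exact: int_cst| |exact: int_cst|]; move=> x;
    by rewrite /= in_itv/= => /andP[/ltW px xq]; exact: g_decr.
have := @Rintegral_itvB R g (BLeft alpha) (BRight q) p.
rewrite !bnd_simp => /(_ (g_integrable _ _) ap pq).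
move/(congr1 (fun t => t + \int[mu]_(x in `[alpha, p]) g x)); rewrite subrK => ->.
rewrite !big_ord_recr/= !mulrDr -/p -/q.
move: IHN piece => /andP[h1 h2] /andP[h3 h4].
by rewrite addrC lerD//= addrC lerD.
Qed.

End riemann_sums.

Section choquet_riemann.
Variables (R : realType) (g : R -> R) (M : R).
Hypothesis g_decr : {homo g : x y /~ x <= y}.
Hypothesis g01 : forall x, 0 <= g x <= 1.
Hypothesis g_top : forall x, M <= x -> g x = 0.
Hypothesis g_bot : forall x, x < - M -> g x = 1.
Local Notation mu := (@lebesgue_measure R).

(** The integrals reduce to [0, M] and [-M, 0]. On each half, left and right Riemann sums differ by
    [h] times the total drop of [g], which is at most [h]; two halves give [2 * h]. *)
Lemma choquet_riemann_sum h N : 0 <= h -> N%:R * h = M ->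
  `|\int[mu]_(x in `[0, +oo[) g x + \int[mu]_(x in `]-oo, 0]) (g x - 1)
    - (h * (\sum_(i < 2 * N) g (M - i.+1%:R * h)) - M)| <= 2 * h.
Proof.
move=> h0 NhM.
have M0 : 0 <= M by rewrite -NhM mulr_ge0.
have -> : \int[mu]_(x in `[0, +oo[) g x = \int[mu]_(x in `[0, 0 + N%:R * h]) g x.
  rewrite Rintegral_mkcond [RHS]Rintegral_mkcond; congr (Rintegral _ _ _).
  apply/funext => x; rewrite !patchE add0r NhM.
  case: ifPn; rewrite mem_setE in_itv/= ?andbT => x0; rewrite ?x0.
    case: ifPn => //; rewrite mem_setE in_itv/= x0 -ltNge => /ltW xM.
    by rewrite g_top.
  by rewrite ifF// mem_setE in_itv/= (negPf x0).
have -> : \int[mu]_(x in `]-oo, 0]) (g x - 1) =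
    \int[mu]_(x in `[- M, - M + N%:R * h]) (g x - 1).
  rewrite Rintegral_mkcond [RHS]Rintegral_mkcond; congr (Rintegral _ _ _).
  apply/funext => x; rewrite !patchE NhM addNr.
  case: ifPn; rewrite mem_setE in_itv/= => x0.
    case: ifPn => //; rewrite mem_setE in_itv/= x0 andbT -ltNge => xM.
    by rewrite g_bot// subrr.
  by rewrite ifF// mem_setE in_itv/= (negPf x0) andbF.
have g1_decr : {homo (fun x => g x - 1) : x y /~ x <= y}.
  by move=> x y xy; rewrite lerD2r g_decr.
have := riemann_sum_bounds g_decr 0 N h0.
have := riemann_sum_bounds g1_decr (- M) N h0.
move: (Rintegral _ _ _) (Rintegral _ _ _) => I1 I2.
have tele (f : R -> R) a :
    h * \sum_(i < N) f (a + i.+1%:R * h) =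
    h * \sum_(i < N) f (a + i%:R * h) - h * (f a - f (a + N%:R * h)).
  rewrite -mulrBr; congr (_ * _).
  have -> : f a - f (a + N%:R * h) = \sum_(i < N) (f (a + i%:R * h) - f (a + i.+1%:R * h)).
    have -> : f a = f (a + 0%:R * h) by rewrite mul0r addr0.
    rewrite -[LHS]opprB.
    rewrite -(telescope_sumr (fun i => f (a + i%:R * h)) (leq0n N)) big_mkord -sumrN.
    by apply: eq_bigr => i _; rewrite opprB.
  by rewrite -sumrB; apply: eq_bigr => i _; ring.
rewrite (tele (fun x => g x - 1) (- M)) (tele g 0).
have -> : - M + N%:R * h = 0 by rewrite NhM addNr.
have -> : 0 + N%:R * h = M by rewrite add0r.
(* Read backwards, the first [N] thresholds are 0, h, ..., M - h and the others are -M, ..., -h: the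
   left endpoints of the two subdivisions. *)
have sumE : h * \sum_(i < 2 * N) g (M - i.+1%:R * h) =
    h * \sum_(i < N) g (0 + i%:R * h) + h * \sum_(i < N) g (- M + i%:R * h).
  rewrite mul2n -addnn big_split_ord/= mulrDr; congr (_ * _ + _ * _).
    rewrite (reindex_inj rev_ord_inj)/=; apply: eq_bigr => i _; congr g.
    by rewrite -NhM subnSK// natrB 1?ltnW//; ring.
  rewrite (reindex_inj rev_ord_inj)/=; apply: eq_bigr => i _; congr g.
  by rewrite -NhM -addnS subnSK// natrD natrB 1?ltnW//; ring.
have sum1 : h * \sum_(i < N) (g (- M + i%:R * h) - 1) =
    h * \sum_(i < N) g (- M + i%:R * h) - M.
  by rewrite sumrB mulrBr sumr_const card_ord -NhM mulrC [X in _ - X]mulrC.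
rewrite sumE sum1 => /andP[h1 h2] /andP[h3 h4].
have b1 : h * (g (- M) - 1 - (g 0 - 1)) <= h.
  rewrite -[leRHS]mulr1 ler_wpM2l//.
  by have /andP[? ?] := g01 (- M); have /andP[? ?] := g01 0; lra.
have b2 : h * (g 0 - g M) <= h.
  rewrite -[leRHS]mulr1 ler_wpM2l//.
  by have /andP[? ?] := g01 M; have /andP[? ?] := g01 0; lra.
by rewrite ler_norml; apply/andP; split; lra.
Qed.
End choquet_riemann.

(** * Staircase approximation of a positive part *)

Section staircase.
Variables (R : realFieldType) (M h : R).
Hypothesis h0 : 0 <= h.

Definition stair (k : nat) (t : R) : R := h * \sum_(i < k) ((M - i.+1%:R * h < t)%R)%:R.

Lemma stair_bounds k t : t <= M ->
  Num.max 0 (t - M + k%:R * h) <= stair k t <= Num.max 0 (t - M + k%:R * h) + h.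
Proof.
move=> tM.
(* The induction also carries vanishing below the lowest threshold: there the two bounds alone would
   allow the value [h], too much for the next step. *)
suff [h1 [h2 _]] : Num.max 0 (t - M + k%:R * h) <= stair k t /\
    stair k t <= Num.max 0 (t - M + k%:R * h) + h /\
    (t - M + k%:R * h <= 0 -> stair k t = 0) by rewrite h1 h2.
rewrite /stair; elim: k => [|k [IH1 [IH2 IH3]]].
  rewrite big_ord0 mulr0 mul0r addr0 max_l ?add0r ?lexx; first by [].
  by rewrite subr_le0.
rewrite big_ord_recr/= mulrDr -natr1.
move: IH1 IH2 IH3; move: (h * \sum_(i < k) _) => S IH1 IH2 IH3.
have -> : M - (k%:R + 1) * h < t = (0 < t - M + k%:R * h + h).
  by rewrite -[LHS]subr_gt0; congr (0 < _); ring.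
rewrite mulrDl mul1r addrA.
move: (t - M + k%:R * h) IH1 IH2 IH3 => r IH1 IH2 IH3.
have [rh|rh] := ltP 0 (r + h); rewrite ?mulr1 ?mulr0 ?addr0.
  have [r0|r0] := leP r 0; last first.
    rewrite !(max_r (ltW r0)) in IH1 IH2.
    by split; [lra|split; [lra|move=> rh'; lra]].
  by rewrite IH3//; split; [lra|split; [lra|move=> rh'; lra]].
by rewrite IH3; [rewrite add0r; split|lra].
Qed.

End staircase.

Lemma sum_by_parts (R : comPzRingType) (p Y : nat -> R) n :
  \sum_(i < n.+1) Y i * (p i - p i.+1) =
  Y 0%N * p 0%N + \sum_(1 <= i < n.+1) (Y i - Y i.-1) * p i - Y n * p n.+1.
Proof.
elim: n => [|n IHn]; first by rewrite big_ord_recr big_ord0 big_nil/=; ring.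
by rewrite big_ord_recr/= IHn [in RHS]big_nat_recr//=; ring.
Qed.

(** * The Choquet integral of a sorted sample *)

Section sample.
Variables (R : realType) (n : nat) (psi : R -> R) (y : 'I_n.+1 -> R).
Hypothesis y_sorted : forall i j : 'I_n.+1, (i <= j)%N -> y i <= y j.
Hypothesis psi0 : psi 0 = 0.
Hypothesis psi1 : psi 1 = 1.
Hypothesis psi_incr : {in `[0, 1] &, {homo psi : s t / s <= t}}.

Let p (i : nat) := psi ((n.+1 - i)%:R / n.+1%:R).
Let count (s : R) : R := n.+1%:R^-1 * \sum_(j < n.+1) ((s < y j)%R)%:R.

Let p0 : p 0 = 1. Proof. by rewrite /p subn0 divff. Qed.
Let pn : p n.+1 = 0. Proof. by rewrite /p subnn mul0r. Qed.

Let p_decr i : p i.+1 <= p i.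
Proof.
have in01 k : (n.+1 - k)%:R / n.+1%:R \in `[0 : R, 1].
  by rewrite in_itv/= divr_ge0//= ler_pdivrMr ?ltr0n// mul1r ler_nat leq_subr.
apply: psi_incr => //; rewrite ler_pM2r ?invr_gt0 ?ltr0n// ler_nat.
exact: leq_sub2l.
Qed.

Let sum_p : \sum_(i < n.+1) (p i - p i.+1) = 1.
Proof.
rewrite -(big_mkord xpredT (fun i => p i - p i.+1)).
have := telescope_sumr p (leq0n n.+1); rewrite p0 pn => E.
rewrite -[RHS]opprK -[- 1]add0r -E -sumrN.
by apply: eq_bigr => i _; rewrite opprB.
Qed.

(** Summation by parts, with [p 0 = 1] and [p n.+1 = 0], turns weights on increments into
    probability weights on the ordered values. *)
Lemma choquet_sampleE : choquet_sample psi y =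
  \sum_(i < n.+1) y i * (p i - p i.+1).
Proof.
pose Y (i : nat) := y (inord i).
rewrite (eq_bigr (fun i : 'I_n.+1 => Y i * (p i - p i.+1))); last first.
  by move=> i _; rewrite /Y inord_val.
have nthY i : (i < n.+1)%N -> [seq y i | i <- enum 'I_n.+1]`_i = Y i.
  move=> ni; rewrite (nth_map ord0) ?size_enum_ord//; congr y.
  by apply: val_inj; rewrite /= nth_enum_ord// inordK.
rewrite sum_by_parts p0 pn mulr1 mulr0 subr0 /choquet_sample nthY//; congr (_ + _).
apply: eq_big_nat => i /andP[i1 ni]; rewrite !nthY// (leq_ltn_trans _ ni)//.
exact: leq_pred.
Qed.

Lemma psi_count (s : R) :
  psi (count s) = \sum_(j < n.+1) (p j - p j.+1) * ((s < y j)%R)%:R.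
Proof.
(* As [y] is sorted, the indices of values above [s] form a final segment starting at [c], with
   [c = n.+1] if there are none; then [psi (count s)] is [p c], a telescoping sum. *)
have [c cn cP] : exists2 c, (c <= n.+1)%N & forall j : 'I_n.+1, (s < y j) = (c <= j)%N.
  pose P c := [forall j : 'I_n.+1, (s < y j) ==> (c <= j)%N].
  have exP : exists c, P c && (c <= n.+1)%N.
    by exists 0%N; rewrite andbT; apply/forallP => j; apply/implyP.
  have bP c : P c && (c <= n.+1)%N -> (c <= n.+1)%N by case/andP.
  case: (ex_maxnP exP bP) => c /andP[/forallP Pc cn] cmax; exists c => // j.
  apply/idP/idP => [sj|cj]; first exact: (implyP (Pc j)).
  rewrite ltNge; apply/negP => ys.
  have : (c.+1 <= c)%N; last by rewrite ltnn.
  apply: cmax; rewrite (leq_ltn_trans cj (ltn_ord j)) andbT.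
  apply/forallP => i; apply/implyP => si; rewrite ltnNge; apply/negP => ic.
  by have := lt_le_trans si (le_trans (y_sorted (leq_trans ic cj)) ys); rewrite ltxx.
under [in RHS]eq_bigr do rewrite cP.
have -> : count s = (n.+1 - c)%:R / n.+1%:R.
  rewrite /count mulrC; congr (_ / _).
  under eq_bigr do rewrite cP.
  rewrite -natr_sum; congr _%:R.
  rewrite -(big_mkord xpredT (fun j => nat_of_bool (c <= j)%N)) (big_cat_nat (leq0n c) cn)/=.
  rewrite big_nat big1 ?add0n; last by move=> j /andP[_ jc]; rewrite leqNgt jc.
  rewrite big_nat (eq_bigr (fun=> 1%N)); last by move=> j /andP[->].
  by rewrite -big_nat sum_nat_const_nat muln1.
rewrite -/(p c) -(big_mkord xpredT (fun j => (p j - p j.+1) * (c <= j)%N%:R)).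
rewrite (big_cat_nat (leq0n c) cn)/=.
rewrite big_nat big1 ?add0r; last by move=> j /andP[_ jc]; rewrite leqNgt jc mulr0.
rewrite big_nat (eq_bigr (fun j => p j - p j.+1)); last by move=> j /andP[-> _]; rewrite mulr1.
rewrite -big_nat; have := telescope_sumr p cn; rewrite pn sub0r => E.
rewrite -[LHS]opprK -E -sumrN.
by apply: eq_bigr => i _; rewrite opprB.
Qed.

Lemma choquet_sample_riemann (M h : R) N : 0 <= h -> N%:R * h = M ->
  (forall j, `|y j| <= M) ->
  `|choquet_sample psi y - (h * (\sum_(i < 2 * N) psi (count (M - i.+1%:R * h))) - M)| <= h.
Proof.
move=> h0 NhM yM.
(* Exchanging the sums gives an average of staircases at the values [y j]. With [2 * N] steps the
   lowest threshold is -M, so each staircase is within [h] of [y j + M]. *)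
have -> : h * \sum_(i < 2 * N) psi (count (M - i.+1%:R * h)) =
    \sum_(j < n.+1) (p j - p j.+1) * stair M h (2 * N) (y j).
  under eq_bigr do rewrite psi_count.
  rewrite exchange_big/= mulr_sumr; apply: eq_bigr => j _.
  by rewrite /stair -mulr_sumr mulrCA.
have -> : choquet_sample psi y =
    \sum_(j < n.+1) (p j - p j.+1) * (y j + M) - M.
  rewrite choquet_sampleE; under [in RHS]eq_bigr do rewrite mulrDr.
  rewrite big_split/= -mulr_suml sum_p mul1r addrK.
  by apply: eq_bigr => j _; rewrite mulrC.
rewrite opprB addrA subrK -sumrB -[leRHS]mul1r -sum_p mulr_suml.
rewrite (le_trans (ler_norm_sum _ _ _))//; apply: ler_sum => j _.
rewrite -mulrBr normrM ger0_norm ?subr_ge0// ler_wpM2l ?subr_ge0//.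
have := yM j; rewrite ler_norml => /andP[y1 y2].
have := stair_bounds h0 (2 * N) y2.
have -> : y j - M + (2 * N)%:R * h = y j + M by rewrite -NhM natrM; ring.
rewrite max_r; last by lra.
by move=> /andP[h1 h2]; rewrite ler_norml; apply/andP; split; lra.
Qed.
End sample.

(** * The law of U, the empirical measure and the star discrepancy *)

Section means.
Variables (R : realType) (d n : nat).

Lemma mean_empirical (u : 'I_n.+1 -> 'rV[R]_d) : (forall i, cube (u i)) ->
  mean (fun F => n.+1%:R^-1 * \sum_(j < n.+1) F (u j)).
Proof.
move=> hu; split=> [|F G _ _|c F _|F G _ _ FG].
- by rewrite sumr_const card_ord mulVf.
- by rewrite big_split mulrDr.
- by rewrite -mulr_sumr mulrCA.
- by rewrite ler_pM2l ?invr_gt0 ?ltr0n// ler_sum// => j _; exact: FG.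
Qed.

Variables (disp : measure_display) (Omega : measurableType disp).
Variables (P : probability Omega R) (U : {RV P >-> borel_rV R d}).
Hypothesis hUcube : forall w, @cube R d (U w).

Let law_integrable (F : 'rV[R]_d -> R) : bounded_borel F ->
  P.-integrable setT (EFin \o (fun w => F (U w))).
Proof.
move=> [mF [B FB]]; apply: measurable_bounded_integrable => //.
- by rewrite (le_lt_trans (probability_le1 P measurableT))// ltry.
- exact: (measurableT_comp mF (measurable_funPT U)).
exists B; split; first by rewrite num_real.
by move=> C BC w _ /=; rewrite (le_trans (FB _ (hUcube w)))// ltW.
Qed.

Lemma mean_law : mean (fun F => \int[P]_w F (U w)).
Proof.
split=> [|F G bF bG|c F bF|F G bF bG FG].
- by rewrite Rintegral_cst// mul1r; exact: (congr1 fine (@probability_setT _ _ _ P)).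
- by rewrite RintegralD//; exact: law_integrable.
- by rewrite RintegralZl//; exact: law_integrable.
- by apply: le_Rintegral; [|exact: law_integrable|exact: law_integrable|move=> w _; exact: FG].
Qed.

Lemma law_indic (A : set 'rV[R]_d) : measurable (A : set (borel_rV R d)) ->
  \int[P]_w (\1_A (U w) : R) = fine (P (U @^-1` A)).
Proof.
move=> mA; congr fine.
rewrite (eq_integral (fun w => (\1_(U @^-1` A) w)%:E))//.
by rewrite integral_indic ?setIT//; exact: measurable_funPTI.
Qed.
End means.

Section star_discrepancy.
Variables (R : realType) (d n : nat) (u : 'I_n.+1 -> 'rV[R]_d.+1).

Let disc (xi : 'rV[R]_d.+1) : R :=
  `|n.+1%:R^-1 * \sum_(j < n.+1) \1_(corner_box xi) (u j) - fine (leb (corner_box xi))|.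

Let leb01 (xi : 'rV[R]_d.+1) : cube xi -> fine (leb (corner_box xi)) = \prod_i xi 0 i.
Proof. by move=> cxi; rewrite leb_corner_box// => i; have /andP[] := cxi i. Qed.

Let disc_le1 xi : cube xi -> disc xi <= 1.
Proof.
move=> cxi; rewrite /disc leb01//.
have p0 : 0 <= \prod_i xi 0 i.
  by apply: prodr_ge0 => i _; have /andP[] := cxi i.
have p1 : \prod_i xi 0 i <= 1.
  by apply: prodr_ile1 => i _; exact: cxi.
have e0 : 0 <= n.+1%:R^-1 * (\sum_(j < n.+1) \1_(corner_box xi) (u j)) :> R.
  by rewrite mulr_ge0// sumr_ge0.
have e1 : n.+1%:R^-1 * (\sum_(j < n.+1) \1_(corner_box xi) (u j)) <= 1 :> R.
  rewrite mulrC ler_pdivrMr ?ltr0n// mul1r.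
  rewrite [leRHS](_ : _ = \sum_(j < n.+1) 1); last by rewrite sumr_const card_ord.
  by rewrite ler_sum.
move: e0 e1 p0 p1; move: (_^-1 * _) (\prod_(_ < _) _) => a b e0 e1 p0 p1.
by rewrite ler_norml; apply/andP; split; lra.
Qed.

Let has_sup_disc : has_sup [set disc xi | xi in @cube R d.+1].
Proof.
split; first by exists (disc 0), 0 => // i; rewrite mxE lexx ler01.
by exists 1 => _ [xi cxi <-]; exact: disc_le1.
Qed.

Lemma le_star_discrepancy xi : cube xi -> disc xi <= star_discrepancy u.
Proof. by move=> cxi; apply: ub_le_sup; [case: has_sup_disc|exists xi]. Qed.

Lemma star_discrepancy_le1 : star_discrepancy u <= 1.
Proof.
by apply: ge_sup => [|_ [xi cxi <-]]; [case: has_sup_disc|exact: disc_le1].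
Qed.

(** A slab of width 1/(2(n+1)) has a volume that is no multiple of 1/(n+1), so its empirical
    frequency is wrong. Positivity makes the scale [delta] of Proinov's inequality admissible. *)
Lemma star_discrepancy_gt0 : 0 < star_discrepancy u.
Proof.
pose xi : 'rV[R]_d.+1 := \row_i (if i == ord0 then (2 * n.+1%:R)^-1 else 1).
have cxi : cube xi.
  move=> i; rewrite mxE; case: ifP => _; last by rewrite ler01 lexx.
  by rewrite invr_ge0 mulr_ge0//= invf_le1// -natrM ler1n.
apply: lt_le_trans (le_star_discrepancy cxi).
rewrite normr_gt0 leb01// [\prod_(_ < _) _]big_ord_recl [\prod_(_ < _) _]big1; last by move=> i _; rewrite mxE.
rewrite mulr1 mxE eqxx subr_eq0; apply/eqP.
have [k ->] : exists k : nat, \sum_(j < n.+1) \1_(corner_box xi) (u j) = k%:R :> R.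
  exists (\sum_(j < n.+1) (u j \in corner_box xi))%N.
  by rewrite natr_sum; apply: eq_bigr => j _; rewrite indicE.
have N0 : n.+1%:R != 0 :> R by rewrite pnatr_eq0.
move=> /(congr1 (fun t => 2 * n.+1%:R * t)); rewrite mulfV ?mulf_neq0//.
have -> : 2 * n.+1%:R * (n.+1%:R^-1 * k%:R) = (2 * k)%:R :> R.
  by rewrite natrM; field.
by move/eqP; rewrite pnatr_eq1; case: k => [|k] //=; rewrite mulnS.
Qed.
End star_discrepancy.

(** * Regularity of the integrand and of the distortion *)

Section continuity.
Variables (R : realType) (d : nat) (f : 'rV[R]_d -> R).
Hypothesis hf : {within @cube R d, continuous f}.

Let has_sup_norm : has_sup [set `|f x| | x in @cube R d].
Proof.
split; first by exists `|f 0|, 0 => // i; rewrite mxE lexx ler01.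
have [B [_ hB]] := compact_bounded (continuous_compact hf (@compact_cube R d)).
exists (B + 1) => _ [x cx <-]; apply: hB; first by rewrite ltrDl.
by exists x.
Qed.

Lemma le_sup_norm_cube x : cube x -> `|f x| <= sup_norm_cube f.
Proof. by move=> cx; apply: ub_le_sup; [case: has_sup_norm|exists x]. Qed.

Lemma le_modulus t x y : cube x -> cube y -> `|x - y| <= t ->
  `|f x - f y| <= modulus f t.
Proof.
move=> cx cy xy; apply: ub_le_sup; last by exists x, y.
exists (sup_norm_cube f + sup_norm_cube f) => _ [v [z [cv cz _ ->]]].
by rewrite (le_trans (ler_normB _ _))// lerD// le_sup_norm_cube.
Qed.

End continuity.

Section distortion.
Variables (R : realType) (psi : R -> R).

Lemma convex_opp_concave01 :
  convex_function (`[0, 1]%classic : set R) (\- psi) -> concave01 psi.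
Proof.
move=> cpsi x y z x0 xy yz z1.
have [zx|zx] := eqVneq z x.
  have yx : y = x by apply/eqP; rewrite eq_le xy andbT -zx.
  by rewrite yx zx !subrr !mul0r addr0.
have z_gt : 0 < z - x by rewrite subr_gt0 lt_neqAle eq_sym zx (le_trans xy).
(* The coefficient for which [y] is the convex combination of [x] and [z]. *)
have t0 : 0 <= (z - y) / (z - x) by rewrite divr_ge0 ?subr_ge0 ?(le_trans xy).
have t1 : (z - y) / (z - x) <= 1 by rewrite ler_pdivrMr// mul1r lerD2l lerN2.
have x01 : x \in `[0, 1]%classic by rewrite inE/= in_itv/= x0 (le_trans (le_trans xy yz)).
have z01 : z \in `[0, 1]%classic by rewrite inE/= in_itv/= z1 (le_trans x0 (le_trans xy yz)).
have : - psi ((z - y) / (z - x) * x + (1 - (z - y) / (z - x)) * z) <=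
    (z - y) / (z - x) * - psi x + (1 - (z - y) / (z - x)) * - psi z.
  exact: (cpsi (Itv01 t0 t1) x z x01 z01).
have -> : (z - y) / (z - x) * x + (1 - (z - y) / (z - x)) * z = y.
  by field; rewrite gt_eqF.
rewrite -(ler_pM2l z_gt).
have -> : (z - x) * ((z - y) / (z - x) * - psi x + (1 - (z - y) / (z - x)) * - psi z) =
    - ((z - y) * psi x + (y - x) * psi z) by field; rewrite gt_eqF.
by rewrite mulrN lerN2.
Qed.

Hypothesis cpsi : concave01 psi.
Hypothesis psi_range : forall t, 0 <= t <= 1 -> 0 <= psi t <= 1.
Hypothesis psi0 : psi 0 = 0.

(** The ratio [psi t / t] is non-increasing, in cross-multiplied form. *)
Lemma concave01_chord r t : 0 <= r -> r <= t -> t <= 1 -> r * psi t <= t * psi r.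
Proof.
move=> r0 rt t1; have := cpsi (lexx 0) r0 rt t1.
by rewrite psi0 mulr0 add0r !subr0.
Qed.

(** The quotients at 0 increase as [s] decreases, so their right limit is their supremum over ]0,
    1]. It dominates every [psi t / t]; the quotient at 1 excludes the value -oo. *)
Lemma right_derive0_ub : (right_derive psi 0 < +oo)%E ->
  exists2 kappa, right_derive psi 0 = kappa%:E &
    forall t, 0 <= t <= 1 -> psi t <= kappa * t.
Proof.
pose q s := ((psi s - psi 0) / (s - 0))%:E.
have qE : right_derive psi 0 = ereal_sup (q @` `]0, 1]).
  apply: cvg_lim => //; apply: (nonincreasing_at_right_cvge (BRight 1)).
    by rewrite bnd_simp.
  move=> s t; rewrite !in_itv/= => /andP[s0 s1] /andP[t0 t1] st.
  rewrite /q psi0 !subr0 lee_fin ler_pdivrMr// mulrAC ler_pdivlMr// mulrC [leRHS]mulrC.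
  by apply: concave01_chord => //; exact: ltW.
have qub t : 0 < t -> t <= 1 -> ((psi t / t)%:E <= right_derive psi 0)%E.
  move=> t0 t1; rewrite qE; apply: ereal_sup_ubound; exists t.
    by rewrite /= in_itv/= t0.
  by rewrite /q psi0 !subr0.
move: qub; case: (right_derive psi 0) => [kappa| |] qub // _; last first.
  by have := qub 1 ltr01 (lexx _).
exists kappa => // t /andP[t0 t1].
have [->|t_neq0] := eqVneq t 0; first by rewrite psi0 mulr0.
have t_gt0 : 0 < t by rewrite lt_neqAle eq_sym t_neq0.
by rewrite -ler_pdivrMr// -lee_fin qub.
Qed.

Lemma psi_small : {within `[0, 1], continuous psi} ->
  forall e, 0 < e -> exists2 r, 0 < r <= 1 & psi r < e.
Proof.
move=> /(continuous_within_itvP _ ltr01)[_ c0 _] e e0.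
move/cvgrPdist_lt : c0 => /(_ _ e0) c0.
have : \forall r \near (0 : R)^'+, [/\ 0 < r, r <= 1 & psi r < e].
  near=> r; split.
  - by near: r; exact: nbhs_right_gt.
  - by near: r; exact: nbhs_right_le.
  - have : `|psi 0 - psi r| < e by near: r.
    by rewrite psi0 sub0r normrN; apply: le_lt_trans; exact: ler_norm.
by move=> /filter_ex[r [r0 r1 pr]]; exists r => //; rewrite r0.
Unshelve. all: by end_near. Qed.

End distortion.

(** * Error estimate for a truncated distortion *)

Section error_bound.
Variables (R : realType) (d n : nat).
Variables (disp : measure_display) (Omega : measurableType disp).
Variables (P : probability Omega R) (U : {RV P >-> borel_rV R d.+1}).
Hypothesis hUcube : forall w, @cube R d.+1 (U w).
Hypothesis hU : uniform_cube U.
Variable f : 'rV[R]_d.+1 -> R.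
Hypothesis hf : {within @cube R d.+1, continuous f}.
Variable u : 'I_n.+1 -> 'rV[R]_d.+1.
Hypothesis hu : forall i, cube (u i).

Variable psi : R -> R.
Hypothesis psi_range : forall t : R, 0 <= t <= 1 -> 0 <= psi t <= 1.
Hypothesis psi_incr : {in `[0, 1] &, {homo psi : s t / s <= t}}.
Hypothesis cpsi : concave01 psi.
Hypotheses (psi0 : psi 0 = 0) (psi1 : psi 1 = 1).
Variable tau : 'S_n.+1.
Hypothesis htau : forall i j : 'I_n.+1, (i <= j)%N -> f (u (tau i)) <= f (u (tau j)).

Let rho := modulus f (star_discrepancy u `^ (d.+1%:R)^-1).
Let M := sup_norm_cube f.
Let tail (s : R) : R := fine (P [set w | s < f (U w)]).
Let count (s : R) : R := n.+1%:R^-1 * \sum_(j < n.+1) ((s < f (u j))%R)%:R.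
Let L1 (F : 'rV[R]_d.+1 -> R) : R := \int[P]_w F (U w).
Let L2 (F : 'rV[R]_d.+1 -> R) : R := n.+1%:R^-1 * \sum_(j < n.+1) F (u j).

Let superlevel (s : R) : set 'rV[R]_d.+1 := @cube R d.+1 `&` [set x | s < f x].

Let measurable_super s : measurable (superlevel s : set (borel_rV R d.+1)).
Proof. exact: measurable_superlevel. Qed.

Let preimage_super s : U @^-1` superlevel s = [set w | s < f (U w)].
Proof. by apply/seteqP; split => [w []|w sw] //; split => //; exact: hUcube. Qed.

Let measurable_tail s : measurable [set w | s < f (U w)].
Proof. by rewrite -preimage_super; exact: (measurable_funPTI U). Qed.

Let L1_super s : L1 (\1_(superlevel s)) = tail s.
Proof. by rewrite /L1 law_indic// preimage_super. Qed.

Let indic_super s x : cube x -> \1_(superlevel s) x = ((s < f x)%R)%:R :> R.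
Proof.
move=> cx; rewrite indicE; congr (nat_of_bool _)%:R.
by apply/idP/idP => [/set_mem[]//|sx]; exact: mem_set.
Qed.

Let L2_super s : L2 (\1_(superlevel s)) = count s.
Proof. by rewrite /L2 /count; congr (_ * _); apply: eq_bigr => j _; rewrite indic_super. Qed.

Let tail01 s : 0 <= tail s <= 1.
Proof.
rewrite fine_ge0//= -lee_fin fineK ?fin_num_measure// probability_le1//.
Qed.

Let tail_decr s t : s <= t -> tail t <= tail s.
Proof.
move=> st; apply: fine_le; rewrite ?fin_num_measure//.
by apply: le_measure; rewrite ?inE// => w /=; exact: le_lt_trans.
Qed.

Let count01 s : 0 <= count s <= 1.
Proof.
rewrite /count mulr_ge0 ?sumr_ge0//= mulrC ler_pdivrMr ?ltr0n// mul1r.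
rewrite [leRHS](_ : _ = \sum_(j < n.+1) 1); last by rewrite sumr_const card_ord.
by apply: ler_sum => j _; case: (_ < _)%R.
Qed.

Let count_decr s t : s <= t -> count t <= count s.
Proof.
move=> st; rewrite ler_pM2l ?invr_gt0 ?ltr0n//; apply: ler_sum => j _.
by case: (ltP t (f (u j))) => // tj; rewrite (le_lt_trans st tj).
Qed.

Let discrepancy_le xi : cube xi ->
  `|L1 (\1_(corner_box xi)) - L2 (\1_(corner_box xi))| <= star_discrepancy u.
Proof.
move=> cxi; apply: le_trans (le_star_discrepancy u cxi).
rewrite distrC /L1 law_indic; last exact: measurable_corner_box.
have -> // : P (U @^-1` corner_box xi) = leb (corner_box xi).
have := hU (measurable_corner_box xi).
rewrite setIidl// => x xxi i; have /andP[-> /ltW xi_lt] := xxi i.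
by rewrite (le_trans xi_lt)//; have /andP[] := cxi i.
Qed.

Let L1_unit_box : L1 (\1_(@unit_box R d.+1)) = 1.
Proof.
have c1 : @cube R d.+1 (const_mx 1) by move=> i; rewrite mxE ler01 lexx.
rewrite /L1 law_indic; last exact: measurable_corner_box.
have -> : P (U @^-1` @unit_box R d.+1) = leb (@unit_box R d.+1).
  have := hU (measurable_corner_box (const_mx 1)).
  by rewrite setIidl//; exact: unit_box_cube.
rewrite leb_corner_box/=; last by move=> i; rewrite mxE ler01.
by rewrite big1// => i _; rewrite mxE.
Qed.

Section scale.
Variables (h : R) (N : nat).
Hypothesis h0 : 0 <= h.
Hypothesis NhM : N%:R * h = M.

(** Up to [h], this is the positive part of f - (M - kh) on the cube. Written with indicators, it is
    Borel and its means are threshold sums of [tail] and [count]. *)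
Let F k (x : 'rV[R]_d.+1) : R := h * \sum_(i < k) \1_(superlevel (M - i.+1%:R * h)) x.

Let bsuper s : bounded_borel (\1_(superlevel s)).
Proof. exact: bounded_borel_indic. Qed.

Let FE k x : cube x -> F k x = stair M h k (f x).
Proof.
by move=> cx; rewrite /F /stair; congr (_ * _); apply: eq_bigr => i _; rewrite indic_super.
Qed.

Let bF k : bounded_borel (F k).
Proof. by apply: bounded_borelZ; exact: bounded_borel_sum. Qed.

Let meanF L k : mean L -> L (F k) = h * \sum_(i < k) L (\1_(superlevel (M - i.+1%:R * h))).
Proof.
move=> mL; rewrite /F (meanZ mL) ?(mean_sum mL)//.
exact: bounded_borel_sum.
Qed.

(** Proinov's inequality for [F k]: taking positive parts does not increase the oscillation [rho] of
    [f], and the staircase adds at most [h]. *)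
Let partial_sum_le k :
  `|h * \sum_(i < k) (tail (M - i.+1%:R * h) - count (M - i.+1%:R * h))| <= 4 * (rho + h).
Proof.
have mL1 : mean L1 by exact: mean_law.
have mL2 : mean L2 by exact: mean_empirical.
have -> : h * \sum_(i < k) (tail (M - i.+1%:R * h) - count (M - i.+1%:R * h)) =
    L1 (F k) - L2 (F k).
  rewrite !meanF// -mulrBr -sumrB; congr (_ * _).
  by apply: eq_bigr => i _; rewrite L1_super L2_super.
have D0 := star_discrepancy_gt0 u.
have D1 := star_discrepancy_le1 u.
have dE : (star_discrepancy u `^ d.+1%:R^-1) ^+ d.+1 = star_discrepancy u.
  by rewrite -powR_mulrn ?powR_ge0// -powRrM mulVf// powRr1// ltW.
apply: (@proinov_inequality R d.+1 L1 L2 (F k) (rho + h) (star_discrepancy u `^ d.+1%:R^-1)) => //.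
- exact: powR_gt0.
- rewrite [leRHS](_ : 1 = 1 `^ d.+1%:R^-1); last by rewrite powR1.
  by apply: ge0_ler_powR => //; rewrite nnegrE ?ler01// ltW.
- by move=> xi cxi; rewrite dE; exact: discrepancy_le.
move=> x y cx cy xy; rewrite !FE//.
have fle := le_modulus hf cx cy xy; rewrite -/rho in fle.
have fM z : cube z -> f z <= M.
  by move=> cz; rewrite (le_trans (ler_norm _))// le_sup_norm_cube.
have /andP[x1 x2] := stair_bounds h0 k (fM _ cx).
have /andP[y1 y2] := stair_bounds h0 k (fM _ cy).
have maxle (s t : R) : s - t <= rho -> Num.max 0 s <= Num.max 0 t + rho.
  move=> st; rewrite ge_max addr_ge0 ?le_max ?lexx ?(le_trans _ fle)//=.
  have : t <= Num.max 0 t by rewrite le_max lexx orbT.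
  by move=> tm; lra.
move: fle; rewrite ler_norml => /andP[f1 f2].
have m1 := maxle (f x - M + k%:R * h) (f y - M + k%:R * h).
have m2 := maxle (f y - M + k%:R * h) (f x - M + k%:R * h).
rewrite ler_norml; apply/andP; split.
  have {}m2 := m2 ltac:(lra); lra.
have {}m1 := m1 ltac:(lra); lra.
Qed.

Variables (kappa beta : R).
Hypothesis psi_min : forall t, 0 <= t <= 1 -> psi t <= Num.min (psi t) (kappa * t) + beta.
Hypothesis kappa0 : 0 <= kappa.

Let err := choquet P psi (fun w => f (U w)) - choquet_sample psi (fun i => f (u (tau i))).

Let distorted_sum_le :
  `|h * \sum_(i < 2 * N) psi (tail (M - i.+1%:R * h)) -
    h * \sum_(i < 2 * N) psi (count (M - i.+1%:R * h))| <=
  4 * kappa * (rho + h) + 2 * M * beta.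
Proof.
have psi_incr' x y : 0 <= x -> x <= y -> y <= 1 -> psi x <= psi y.
  by move=> x0 xy y1; apply: psi_incr => //; rewrite in_itv/= ?x0 ?y1 ?(le_trans xy)// (le_trans x0).
have s_decr : {homo (fun i : nat => M - i.+1%:R * h) : i j / (i <= j)%N >-> j <= i}.
  by move=> i j ij; rewrite lerD2l lerN2 ler_wpM2r// ler_nat ltnS.
pose phi t := Num.min (psi t) (kappa * t).
have phi_diff : h * `|\sum_(i < 2 * N) (phi (tail (M - i.+1%:R * h)) -
    phi (count (M - i.+1%:R * h)))| <= kappa * (4 * (rho + h)).
  (* The step can be 0, namely when [M] is 0; otherwise the partial sums of [tail - count] are
     bounded by 4 (rho + h) / h. *)
  have [h_eq0|h_neq0] := eqVneq h 0.
    have E0 := le_trans (normr_ge0 _) (partial_sum_le 0).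
    by rewrite [X in X * `|_|]h_eq0 mul0r mulr_ge0.
  have h_gt0 : 0 < h by rewrite lt_neqAle eq_sym h_neq0.
  rewrite mulrC -ler_pdivlMr// -mulrA.
  apply: (@concave_sum_le R phi _ kappa _ _ _ (fun i => tail (M - i.+1%:R * h))
    (fun i => count (M - i.+1%:R * h))) => //.
  - by apply: concave01_min => //; exact: concave01_linear.
  - move=> x y x0 xy y1; rewrite /phi le_min !ge_min psi_incr'//=.
    by rewrite [kappa * x <= kappa * y]ler_wpM2l// orbT.
  - by rewrite /phi psi0 mulr0 minxx.
  - by move=> t _; rewrite /phi ge_min lexx orbT.
  - by move=> i j ij; apply: tail_decr; exact: s_decr.
  - by move=> i j ij; apply: count_decr; exact: s_decr.
  move=> k _; rewrite ler_pdivlMr// mulrC -[X in X * _]ger0_norm// -normrM.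
  exact: partial_sum_le.
(* Both gaps [psi - phi] lie in [0, beta], so their difference costs [beta] only once; over [2 * N]
   terms of weight [h] this gives 2 M beta. *)
have corr (t s : R) : 0 <= t <= 1 -> 0 <= s <= 1 ->
    `|(psi t - psi s) - (phi t - phi s)| <= beta.
  move=> t01 s01; have t1 := psi_min t01; have s1 := psi_min s01.
  have t2 : phi t <= psi t by rewrite ge_min lexx.
  have s2 : phi s <= psi s by rewrite ge_min lexx.
  by rewrite -/(phi t) in t1; rewrite -/(phi s) in s1; rewrite ler_norml; apply/andP; split; lra.
rewrite -mulrBr -sumrB.
have -> : \sum_(i < 2 * N) (psi (tail (M - i.+1%:R * h)) - psi (count (M - i.+1%:R * h))) =
   \sum_(i < 2 * N) (phi (tail (M - i.+1%:R * h)) - phi (count (M - i.+1%:R * h))) +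
   \sum_(i < 2 * N) ((psi (tail (M - i.+1%:R * h)) - psi (count (M - i.+1%:R * h))) -
     (phi (tail (M - i.+1%:R * h)) - phi (count (M - i.+1%:R * h)))).
  by rewrite -big_split; apply: eq_bigr => i _ /=; ring.
rewrite normrM (ger0_norm h0) (le_trans (ler_wpM2l h0 (ler_normD _ _)))// mulrDr.
have -> : 4 * kappa * (rho + h) = kappa * (4 * (rho + h)) by ring.
rewrite lerD//.
have -> : 2 * M * beta = h * \sum_(i < 2 * N) beta.
  by rewrite sumr_const card_ord -NhM -[beta *+ _]mulr_natr natrM; ring.
rewrite ler_wpM2l// (le_trans (ler_norm_sum _ _ _))//.
by apply: ler_sum => i _; exact: corr.
Qed.

Lemma choquet_error_scale : `|err| <= 4 * kappa * rho + 2 * M * beta + (4 * kappa + 3) * h.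
Proof.
have in01 t : 0 <= t <= 1 -> t \in `[0, 1] by rewrite in_itv.
have c1 : `|choquet P psi (fun w => f (U w)) -
    (h * (\sum_(i < 2 * N) psi (tail (M - i.+1%:R * h))) - M)| <= 2 * h.
  apply: (@choquet_riemann_sum R (fun s => psi (tail s)) M) => //.
  - by move=> s t st; apply: psi_incr; [exact: in01|exact: in01|exact: tail_decr].
  - by move=> s; exact: psi_range.
  - move=> s Ms; rewrite /tail (_ : [set w | _] = set0) ?measure0//.
    apply/seteqP; split => // w /=; apply/negP; rewrite -leNgt.
    by apply: le_trans Ms; rewrite (le_trans (ler_norm _))// le_sup_norm_cube.
  - move=> s Ms; rewrite /tail (_ : [set w | _] = setT) ?probability_setT//.
    apply/seteqP; split => // w _ /=; apply: lt_le_trans Ms _.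
    have : `|f (U w)| <= M by exact: le_sup_norm_cube.
    by rewrite ler_norml => /andP[].
have c2 : `|choquet_sample psi (fun i => f (u (tau i))) -
    (h * (\sum_(i < 2 * N) psi (count (M - i.+1%:R * h))) - M)| <= h.
  (* The empirical count is invariant under the reordering [tau]. *)
  have -> : \sum_(i < 2 * N) psi (count (M - i.+1%:R * h)) =
     \sum_(i < 2 * N) psi (n.+1%:R^-1 *
       \sum_(j < n.+1) ((M - i.+1%:R * h < f (u (tau j)))%R)%:R).
    apply: eq_bigr => i _; congr (psi (_ * _)).
    by rewrite (reindex_inj (@perm_inj _ tau)).
  apply: choquet_sample_riemann => // j; exact: le_sup_norm_cube.
have c3 := distorted_sum_le.
rewrite /err; move: c1 c2 c3; rewrite !ler_norml.
move: (choquet _ _ _) (choquet_sample _ _) (h * _) (h * _) => A B S T.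
by move=> /andP[? ?] /andP[? ?] /andP[? ?]; apply/andP; split; lra.
Qed.

End scale.

(** Lets [h] tend to 0: [N] is chosen so that the remaining (4 kappa + 3) M / (N + 1) is at most
    [e]. *)
Lemma choquet_error_le (kappa beta : R) : 0 <= kappa ->
  (forall t, 0 <= t <= 1 -> psi t <= Num.min (psi t) (kappa * t) + beta) ->
  `|choquet P psi (fun w => f (U w)) - choquet_sample psi (fun i => f (u (tau i)))| <=
  4 * kappa * rho + 2 * M * beta.
Proof.
move=> kappa0 psi_min; apply/ler_addgt0Pr => e e0.
have M0 : 0 <= M by apply: le_trans (normr_ge0 _) (le_sup_norm_cube hf (hu ord0)).
have C0 : 0 <= 4 * kappa + 3 by rewrite addr_ge0// mulr_ge0.
pose N := Num.truncn ((4 * kappa + 3) * M / e).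
have /andP[_ N1] : N%:R <= (4 * kappa + 3) * M / e < N.+1%:R.
  by apply: truncn_itv; rewrite divr_ge0 ?mulr_ge0// ltW.
have h0 : 0 <= M / N.+1%:R by rewrite divr_ge0.
have NhM : N.+1%:R * (M / N.+1%:R) = M by rewrite mulrC divfK.
apply: le_trans (choquet_error_scale h0 NhM psi_min kappa0) _.
rewrite lerD2l mulrA ler_pdivrMr ?ltr0n//.
by move/ltW: N1; rewrite ler_pdivrMr// [leRHS]mulrC.
Qed.

End error_bound.

Theorem theorem1 (R : realType) (d n : nat) (hd : (1 <= d)%N) (hn : (1 <= n)%N)
    (disp : measure_display) (Omega : measurableType disp)
    (P : probability Omega R) (hP : atomless P)
    (U : {RV P >-> borel_rV R d})
    (hUcube : forall w, @cube R d (U w)) (hU : uniform_cube U)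
    (f : 'rV[R]_d -> R) (hf : {within @cube R d, continuous f})
    (psi : R -> R)
    (psi_range : forall t : R, 0 <= t <= 1 -> 0 <= psi t <= 1)
    (psi_cont : {within `[0, 1], continuous psi})
    (psi_incr : {in `[0, 1] &, {homo psi : s t / s <= t}})
    (psi_concave : convex_function (`[0, 1]%classic : set R) (\- psi))
    (psi0 : psi 0 = 0) (psi1 : psi 1 = 1)
    (u : 'I_n -> 'rV[R]_d) (hu : forall i, cube (u i))
    (tau : 'S_n)
    (htau : forall i j : 'I_n, (i <= j)%N -> f (u (tau i)) <= f (u (tau j))) :
  let rho := modulus f (star_discrepancy u `^ (d%:R)^-1) in
  let err := `|choquet P psi (fun w => f (U w))
               - choquet_sample psi (fun i => f (u (tau i)))| in
  (rho < 1 -> err <= (2 * sup_norm_cube f + 4) * psi rho)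
  /\
  ((right_derive psi 0 < +oo)%E ->
     (err%:E <= 4%:E * right_derive psi 0 * rho%:E)%E).
Proof.
case: n hn u hu tau htau => [//|n' _] {}u {}hu {}tau {}htau.
case: d hd U hUcube hU f hf u hu htau => [//|d' _] {}U {}hUcube {}hU {}f {}hf {}u {}hu {}htau.
move=> rho err.
have cpsi := convex_opp_concave01 psi_concave.
have rho0 : 0 <= rho.
  by apply: le_trans (normr_ge0 _) (le_modulus hf (hu ord0) (hu ord0) _);
    rewrite subrr normr0 powR_ge0.
have M0 : 0 <= sup_norm_cube f.
  by apply: le_trans (normr_ge0 _) (le_sup_norm_cube hf (hu ord0)).
have bound := choquet_error_le hUcube hU hf hu psi_range psi_incr cpsi psi0 psi1 htau.
(* Here [kappa = psi r / r] and [beta = psi r]: from [r] on, [psi] lies below the line of slope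
   [kappa], and before [r] it is at most [psi r]. A free [r] is kept for the case [rho = 0]. *)
have boundr r : 0 < r -> r <= 1 ->
    err <= 4 * (psi r / r) * rho + 2 * sup_norm_cube f * psi r.
  move=> r0 r1; have /andP[pr0 _] : 0 <= psi r <= 1 by rewrite psi_range// ltW.
  apply: bound => [|t t01]; first by rewrite divr_ge0// ltW.
  have /andP[t0 t1] := t01.
  have /andP[pt0 _] := psi_range t t01.
  have [rt|tr] := leP r t.
    rewrite min_l ?lerDl// mulrAC ler_pdivlMr// mulrC [leRHS]mulrC.
    exact: concave01_chord (ltW r0) rt t1.
  have ptr : psi t <= psi r.
    by apply: psi_incr; rewrite ?in_itv/= ?t0 ?(ltW r0)// ltW.
  by rewrite (le_trans ptr)// lerDr le_min pt0 mulr_ge0// divr_ge0// ltW.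
split=> [rho1|rd].
  (* For [rho = 0] the slope [psi rho / rho] is meaningless; instead [r] is sent to 0, where [psi r]
     vanishes. *)
  have [rho_eq0|rho_neq0] := eqVneq rho 0.
    rewrite rho_eq0 psi0 mulr0; apply/ler_addgt0Pr => e e0; rewrite add0r.
    have C0 : 0 < 2 * sup_norm_cube f + 1 by rewrite ltr_wpDl// mulr_ge0.
    have [r /andP[r0 r1] pr] := psi_small psi0 psi_cont (divr_gt0 e0 C0).
    apply: le_trans (boundr _ r0 r1) _. rewrite rho_eq0 mulr0 add0r.
    move: pr; rewrite ltr_pdivlMr// => /ltW; apply: le_trans.
    rewrite mulrC ler_wpM2l ?lerDl//.
    by have /andP[] : 0 <= psi r <= 1 by rewrite psi_range// ltW.
  have rho_gt0 : 0 < rho by rewrite lt_neqAle eq_sym rho_neq0.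
  apply: le_trans (boundr _ rho_gt0 (ltW rho1)) _.
  by rewrite -mulrA divfK// -mulrDl addrC.
have [kappa kE kub] := right_derive0_ub cpsi psi0 rd.
rewrite kE -!EFinM lee_fin.
have k0 : 0 <= kappa.
  have := kub 1; rewrite psi1 mulr1 lexx ler01 => /(_ isT).
  exact: le_trans.
(* With [kappa] the right derivative at 0, the truncation changes nothing and [beta] is 0. *)
rewrite -[leRHS]addr0 -(mulr0 (2 * sup_norm_cube f)); apply: bound => // t t01.
by rewrite addr0 le_min lexx kub.
Qed.
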